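(* Let $D$ be a finitely connected domain with $\infty\in D$ and $0\notin D$, and let $n$ be the number of connected components of $\hat{\mathbb{C}}\setminus D$. From a name of $D$, a name of $\partial D$, and $n$, one can uniformly compute: - a labeling $D_{0,1},\dots,D_{0,n}$ of the connected components of $\hat{\mathbb{C}}\setminus D$; - names of the open sets $\hat{\mathbb{C}}\setminus D_{0,1},\dots,\hat{\mathbb{C}}\setminus D_{0,n}$; - names of the closed sets $\partial D_{0,1},\dots,\partial D_{0,n}$.
   Context: Computability is in the sense of Type-Two Effectivity. $\hat{\mathbb{C}}=\mathbb{C}\cup\{\infty\}$, and $D_r(z)$ is the open disk of radius $r$ centered at $z$. The basic open sets are the open rectangles whose vertices have rational coordinates, together with the sets $\hat{\mathbb{C}}\setminus\overline{D_r(0)}$ with $r$ rational. Names: - A name of a point $z\in\hat{\mathbb{C}}$ is a list of all basic open sets containing $z$. - A name of an open set $U$ is a list of all basic open sets whose closures lie in $U$. - A name of a closed set $C$ is a list of all basic open sets meeting $C$. - ''Uniformly computable'' means a single Turing machine with one-way output tape, given names of the data, writes names of the outputs. A domain is an open connected subset of $\hat{\mathbb{C}}$. It is finitely connected if its complement has finitely many connected components. *)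

(* Defs.v *)
From mathcomp Require Import all_boot all_algebra.
From mathcomp Require Import reals.

Set Implicit Arguments.
Unset Strict Implicit.
Unset Printing Implicit Defensive.
Import GRing.Theory Num.Theory.
Local Open Scope ring_scope.

Inductive rf : Type :=
| RZero : rf
| RSucc : rf
| RProj : nat -> rf
| RComp : rf -> seq rf -> rf
| RPrec : rf -> rf -> rf
| RMu   : rf -> rf.

Inductive rf_eval : rf -> seq nat -> nat -> Prop :=
| ev_zero v : rf_eval RZero v 0
| ev_succ x v : rf_eval RSucc (x :: v) x.+1
| ev_proj i v : (i < size v)%N -> rf_eval (RProj i) v (nth 0%N v i)
| ev_comp f gs v ys y :
    rf_evals gs v ys -> rf_eval f ys y -> rf_eval (RComp f gs) v y
| ev_prec0 f g v y : rf_eval f v y -> rf_eval (RPrec f g) (0%N :: v) y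
| ev_precS f g k v r y :
    rf_eval (RPrec f g) (k :: v) r -> rf_eval g (k :: r :: v) y ->
    rf_eval (RPrec f g) (k.+1 :: v) y
| ev_mu f v k :
    rf_eval f (k :: v) 0 ->
    (forall m, (m < k)%N -> exists r, rf_eval f (m :: v) r.+1) ->
    rf_eval (RMu f) v k
with rf_evals : seq rf -> seq nat -> seq nat -> Prop :=
| evs_nil v : rf_evals [::] v [::]
| evs_cons g gs v y ys :
    rf_eval g v y -> rf_evals gs v ys -> rf_evals (g :: gs) v (y :: ys).

Definition cpair (x y : nat) : nat := (((x + y) * (x + y).+1)./2 + y)%N.

Fixpoint code_word (w : seq nat) : nat :=
  match w with
  | [::] => 0%N
  | x :: w' => (cpair x (code_word w')).+1
  end.

Definition prefix (p : nat -> nat) (m : nat) : seq nat := mkseq p m.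

(* A (total) recursive function M of four arguments realises a TTE machine
   with inputs (n, p1, p2) (n : nat, p1 p2 : Baire-space names) and output
   q : nat -> nat: on input k, n and the codes of the first m symbols of p1 and
   p2, M answers 0 ("no output yet") or v.+1 ("output symbol number k is v").
   This is the standard characterisation of TTE-computable (one-way output
   tape) functionals via monotone computable word functions. *)
Definition rf_total4 (M : rf) : Prop :=
  forall a b c d : nat, exists y, rf_eval M [:: a; b; c; d] y.

Definition machine_computes (M : rf) (n : nat) (p1 p2 q : nat -> nat) : Prop :=
  (forall k, exists m,
      rf_eval M [:: k; n; code_word (prefix p1 m); code_word (prefix p2 m)]
              (q k).+1) /\
  (forall k m v,
      rf_eval M [:: k; n; code_word (prefix p1 m); code_word (prefix p2 m)] v.+1 ->
      v = q k).

(* None is the point at infinity; Some (x, y) is x + i y. *)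
Definition Chat (R : realType) := option (R * R).

Definition cset (R : realType) := Chat R -> Prop.

(* basic open set codes: open rational rectangles (a,b) x (c,d), and
   exteriors  Chat \ closed disk of radius r centred at 0  *)
Definition basic := ((rat * rat) * (rat * rat) + rat)%type.

Definition basic_valid (b : basic) : Prop :=
  match b with
  | inl ((a, b'), (c, d)) => a < b' /\ c < d
  | inr r => 0 < r
  end.

Definition in_basic (R : realType) (b : basic) (z : Chat R) : Prop :=
  match b, z with
  | inl ((a, b'), (c, d)), Some (x, y) =>
      ratr a < x /\ x < ratr b' /\ ratr c < y /\ y < ratr d
  | inl _, None => False
  | inr r, Some (x, y) => (ratr r) ^+ 2 < x ^+ 2 + y ^+ 2
  | inr _, None => True
  end.

(* closure (in Chat) of the basic open set coded by a valid b *)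
Definition in_basic_cl (R : realType) (b : basic) (z : Chat R) : Prop :=
  match b, z with
  | inl ((a, b'), (c, d)), Some (x, y) =>
      ratr a <= x /\ x <= ratr b' /\ ratr c <= y /\ y <= ratr d
  | inl _, None => False
  | inr r, Some (x, y) => (ratr r) ^+ 2 <= x ^+ 2 + y ^+ 2
  | inr _, None => True
  end.

Definition copen (R : realType) (U : cset R) : Prop :=
  forall z, U z -> exists b, basic_valid b /\ in_basic b z /\
                       (forall w, in_basic b w -> U w).

Definition ccompl (R : realType) (S : cset R) : cset R := fun z => ~ S z.

Definition cclosure (R : realType) (S : cset R) : cset R :=
  fun z => forall b, basic_valid b -> in_basic b z -> exists w, in_basic b w /\ S w.

Definition cinterior (R : realType) (S : cset R) : cset R :=
  fun z => exists b, basic_valid b /\ in_basic b z /\ (forall w, in_basic b w -> S w).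

Definition cboundary (R : realType) (S : cset R) : cset R :=
  fun z => cclosure S z /\ ~ cinterior S z.

Definition cconnected (R : realType) (S : cset R) : Prop :=
  ~ exists U V : cset R, copen U /\ copen V /\
      (forall z, S z -> U z \/ V z) /\
      (exists z, S z /\ U z) /\ (exists z, S z /\ V z) /\
      (forall z, ~ (S z /\ U z /\ V z)).

Definition ccomponent_of (R : realType) (S : cset R) (x : Chat R) : cset R :=
  fun z => exists T : cset R, cconnected T /\ (forall w, T w -> S w) /\ T x /\ T z.

Definition is_component (R : realType) (S K : cset R) : Prop :=
  exists x, S x /\ forall z, K z <-> ccomponent_of S x z.

Definition cdomain (R : realType) (D : cset R) : Prop :=
  copen D /\ cconnected D /\ exists z, D z.

Definition component_labeling (R : realType) (S : cset R) (n : nat)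
    (C : 'I_n -> cset R) : Prop :=
  (forall l, is_component S (C l)) /\
  (forall l l', (forall z, C l z <-> C l' z) -> l = l') /\
  (forall K, is_component S K -> exists l, forall z, K z <-> C l z).

(* Names.  A name lists (with padding symbol 0, repetitions allowed) a set   *)
(* of basic open sets: p k = 0 is "no entry", p k = (pickle b).+1 lists b.   *)
Definition lists_exactly (P : basic -> Prop) (p : nat -> nat) : Prop :=
  (forall k, p k = 0%N \/ exists b, P b /\ p k = (pickle b).+1) /\
  (forall b, P b -> exists k, p k = (pickle b).+1).

Definition open_name (R : realType) (U : cset R) (p : nat -> nat) : Prop :=
  lists_exactly (fun b => basic_valid b /\ forall z, in_basic_cl b z -> U z) p.

Definition closed_name (R : realType) (C : cset R) (p : nat -> nat) : Prop :=
  lists_exactly (fun b => basic_valid b /\ exists z, in_basic b z /\ C z) p.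

Definition substream (q : nat -> nat) (i : nat) : nat -> nat :=
  fun j => q (cpair i j).

(* Output specification: streams 2l and 2l+1 (l < n) are names of
   Chat \ D_{0,l+1} and of the boundary of D_{0,l+1}, where
   D_{0,1}, ..., D_{0,n} is a labeling of the components of Chat \ D. *)
Definition valid_output (R : realType) (D : cset R) (n : nat) (q : nat -> nat) : Prop :=
  exists C : 'I_n -> cset R,
    component_labeling (ccompl D) C /\
    forall l : 'I_n,
      open_name (ccompl (C l)) (substream q (2 * l)) /\
      closed_name (cboundary (C l)) (substream q (2 * l).+1).

(* Main.v *)
(* Let K be the complement of D. Lay a fine grid over a box containing K and take
   around each grid point the open square whose half-side is the mesh. Search for a
   labelling of the grid points by 0, ..., n such that squares labelled 0 lie in sets
   listed by the name of D, neighbouring nonzero labels agree, and every label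
   1, ..., n has a square containing a set listed by the name of the boundary. The n
   unions of squares with equal nonzero label are then open, disjoint, cover K and
   each meet K, so, K having n components, each contains exactly one of them. The
   search succeeds because the components have positive distance and each of them
   contains a boundary point of D.

   Once a labelling is fixed, a basic set b has its closure off the component C_l iff
   on some finer grid every square misses the closure of b, or is not labelled l, or
   lies in a listed subset of D (a Lebesgue number argument); and b meets the boundary
   of C_l iff on some finer grid a square labelled l lies in b and contains a listed
   set meeting the boundary of D. Both conditions are semidecidable. *)
Require Import Defs.
From mathcomp Require Import all_boot all_algebra.
From mathcomp Require Import reals.
From mathcomp Require Import all_order boolp classical_sets zify ring lra.

Set Implicit Arguments.
Unset Strict Implicit.
Unset Printing Implicit Defensive.
Import Order.TTheory GRing.Theory Num.Theory.

(** Names give only positive information: a machine never learns that a set is absent, so it cannot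
    decide whether two points of K lie in one component. The number [n] makes up for this. That [n]
    disjoint open sets cover K and each meet it is certified by finitely many listed sets, and
    counting then forces each of them to hold exactly one component, although no connectedness is
    ever verified. Which certificate is found first depends on the names, and so does the labelling
    of the components.

    The machine must be a total function of finite prefixes. Certificates are therefore natural
    numbers [t], tested on at most [t] symbols of the names; the least one is unaffected by longer
    prefixes, and every answer refers to it. A semidecidable condition on basic sets becomes a
    stream by letting the position in the stream carry the basic set, the refinement of the grid and
    the stage: each position is one decidable test, and failure yields the padding symbol. *)

(** * Closure properties of the computable functions *)

Definition computable (k : nat) (f : seq nat -> nat) : Prop :=
  exists r, forall v, size v = k -> rf_eval r v (f v).

Lemma computable_ext k f g :
  (forall v, size v = k -> f v = g v) -> computable k f -> computable k g.
Proof. by move=> fg [r rP]; exists r => v sv; rewrite -fg //; apply: rP. Qed.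

Lemma computable_nth k i : i < k -> computable k (fun v => nth 0 v i).
Proof. by move=> ik; exists (RProj i) => v sv; apply: ev_proj; rewrite sv. Qed.

Lemma computable_head k : computable k.+1 (fun w => head 0 w).
Proof.
by apply: computable_ext (@computable_nth k.+1 0 isT) => v; rewrite nth0.
Qed.

Lemma computable_comp k m F (gs : seq (seq nat -> nat)) :
  computable m F -> size gs = m ->
  (forall i, i < m -> computable k (nth (fun=> 0) gs i)) ->
  computable k (fun v => F [seq g v | g <- gs]).
Proof.
move=> [r rP] sgs cgs.
have [rs rsP] : exists rs, forall v, size v = k ->
    rf_evals rs v [seq g v | g <- gs].
  rewrite -{}sgs in cgs; elim: gs cgs => [|g gs IH] cgs.
    by exists [::] => v _; apply: evs_nil.
  have [rs rsP] := IH (fun i => cgs i.+1); have [r1 r1P] := cgs 0 isT.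
  by exists (r1 :: rs) => v sv /=; apply: evs_cons; [apply: r1P|apply: rsP].
exists (RComp r rs) => v sv; apply: (@ev_comp _ _ _ [seq g v | g <- gs]).
  exact: rsP.
by apply: rP; rewrite size_map.
Qed.

Lemma computable_comp1 k F f :
  computable 1 (fun v => F (head 0 v)) -> computable k f ->
  computable k (fun v => F (f v)).
Proof.
by move=> cF cf; apply: (computable_comp cF (gs := [:: f])) => // -[].
Qed.

Lemma computable_weaken k f :
  computable k f -> computable k.+1 (fun w => f (behead w)).
Proof.
move=> cf.
pose gs := [seq (fun w : seq nat => nth 0 w i.+1) | i <- iota 0 k].
have sgs : size gs = k by rewrite size_map size_iota.
apply: (@computable_ext _ (fun w => f [seq g w | g <- gs])).
  move=> w sw; congr f; apply: (@eq_from_nth _ 0).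
    by rewrite size_map sgs size_behead sw.
  move=> i; rewrite size_map sgs => ik.
  by rewrite (nth_map (fun=> 0)) ?sgs// (nth_map 0) ?size_iota// nth_iota// nth_behead.
apply: computable_comp cf sgs _ => i ik.
rewrite (nth_map 0) ?size_iota// nth_iota//; exact: computable_nth.
Qed.

(** [RPrec] recurses on its first argument, so the bound [n v] is prepended to [v] by composing with
    all projections. *)
Lemma computable_rec k b st n :
  computable k b -> computable k.+2 st -> computable k n ->
  computable k (fun v => nat_rect (fun=> nat) (b v) (fun i r => st (i :: r :: v)) (n v)).
Proof.
move=> [rb rbP] [rs rsP] cn.
have crec : computable k.+1 (fun w => nat_rect (fun=> nat) (b (behead w))
    (fun i r => st (i :: r :: behead w)) (head 0 w)).
  exists (RPrec rb rs) => -[|n0 v] //= [sv].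
  elim: n0 => [|n0 IH] /=; first by apply: ev_prec0; apply: rbP.
  by apply: ev_precS IH _; apply: rsP; rewrite /= sv.
pose gs := n :: [seq (fun w : seq nat => nth 0 w i) | i <- iota 0 k].
have sgs : size gs = k.+1 by rewrite /= size_map size_iota.
apply: computable_ext (computable_comp (k := k) crec sgs _) => [v sv|[|i] ik] //=.
  rewrite -map_comp /comp.
  by have -> : [seq nth 0 v x | x <- iota 0 k] = v by rewrite -sv map_nth_iota0 ?take_size.
rewrite (nth_map 0) ?size_iota// nth_iota//; exact: computable_nth.
Qed.

Lemma computable_const k c : computable k (fun=> c).
Proof.
elim: c => [|c [r rP]]; first by exists RZero => v _; apply: ev_zero.
exists (RComp RSucc [:: r]) => v sv; apply: (@ev_comp _ _ _ [:: c]).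
  by apply: evs_cons (rP _ sv) (evs_nil _).
exact: ev_succ.
Qed.

Lemma computable_succ k f : computable k f -> computable k (fun v => (f v).+1).
Proof.
by apply: computable_comp1; exists RSucc => -[|x [|]] //= _; apply: ev_succ.
Qed.

Lemma computable_add k f g :
  computable k f -> computable k g -> computable k (fun v => f v + g v).
Proof.
move=> cf cg; have cst := computable_succ (@computable_nth k.+2 1 isT).
apply: computable_ext (computable_rec cf cst cg) => v _.
by elim: (g v) => [|m IH] /=; rewrite ?addn0 ?addnS ?IH.
Qed.

Lemma computable_mul k f g :
  computable k f -> computable k g -> computable k (fun v => f v * g v).
Proof.
move=> cf cg; have cst := computable_add
  (computable_weaken (computable_weaken cf)) (@computable_nth k.+2 1 isT).
apply: computable_ext (computable_rec (computable_const k 0) cst cg) => v _ /=.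
by elim: (g v) => [|m IH] /=; rewrite ?muln0 ?mulnS ?IH.
Qed.

Lemma computable_exp k f g :
  computable k f -> computable k g -> computable k (fun v => f v ^ g v).
Proof.
move=> cf cg; have cst := computable_mul
  (computable_weaken (computable_weaken cf)) (@computable_nth k.+2 1 isT).
apply: computable_ext (computable_rec (computable_const k 1) cst cg) => v _ /=.
by elim: (g v) => [|m IH] /=; rewrite ?expn0 ?expnS ?IH.
Qed.

Lemma computable_pred k f : computable k f -> computable k (fun v => (f v).-1).
Proof.
move=> cf; have cst := @computable_nth k.+2 0 isT.
apply: computable_ext (computable_rec (computable_const k 0) cst cf) => v _ /=.
by case: (f v).
Qed.

Lemma computable_sub k f g :
  computable k f -> computable k g -> computable k (fun v => f v - g v).
Proof.
move=> cf cg; have cst := computable_pred (@computable_nth k.+2 1 isT).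
apply: computable_ext (computable_rec cf cst cg) => v _ /=.
by elim: (g v) => [|m IH] /=; rewrite ?subn0 ?subnS ?IH.
Qed.

Lemma computable_iter k F n x :
  computable 1 (fun v => F (head 0 v)) -> computable k n -> computable k x ->
  computable k (fun v => iter (n v) F (x v)).
Proof.
move=> cF cn cx; have cst := computable_comp1 cF (@computable_nth k.+2 1 isT).
apply: computable_ext (computable_rec cx cst cn) => v _ /=.
by elim: (n v) => //= m ->.
Qed.

Lemma computable_leq k f g :
  computable k f -> computable k g -> computable k (fun v => f v <= g v).
Proof.
move=> cf cg; have c1 := computable_sub (computable_const k 1) (computable_sub cf cg).
by apply: computable_ext c1 => v _; rewrite leqNgt; case: ltnP; lia.
Qed.

Lemma computable_negb k (p : seq nat -> bool) :
  computable k p -> computable k (fun v => ~~ p v).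
Proof.
move=> cp; apply: computable_ext (computable_sub (computable_const k 1) cp) => v _.
by case: (p v).
Qed.

Lemma computable_andb k (p q : seq nat -> bool) :
  computable k p -> computable k q -> computable k (fun v => p v && q v).
Proof.
move=> cp cq; apply: computable_ext (computable_mul cp cq) => v _.
by case: (p v); case: (q v).
Qed.

Lemma computable_orb k (p q : seq nat -> bool) :
  computable k p -> computable k q -> computable k (fun v => p v || q v).
Proof.
move=> cp cq.
apply: computable_ext (computable_negb (computable_andb (computable_negb cp) (computable_negb cq))).
by move=> v _; case: (p v); case: (q v).
Qed.

Lemma computable_eq k f g :
  computable k f -> computable k g -> computable k (fun v => f v == g v).
Proof.
move=> cf cg.
have c := computable_andb (computable_leq cf cg) (computable_leq cg cf).
by apply: computable_ext c => v _; rewrite eqn_leq.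
Qed.

Lemma computable_if k (p : seq nat -> bool) f g :
  computable k p -> computable k f -> computable k g ->
  computable k (fun v => if p v then f v else g v).
Proof.
move=> cp cf cg; apply: computable_ext (computable_add (computable_mul cp cf)
  (computable_mul (computable_negb cp) cg)) => v _.
by case: (p v); rewrite /= ?mul1n ?mul0n ?addn0.
Qed.

Lemma computable_ifb k (p q r : seq nat -> bool) :
  computable k p -> computable k q -> computable k r ->
  computable k (fun v => if p v then q v else r v).
Proof.
move=> cp cq cr; apply: computable_ext (computable_if cp cq cr) => v _.
by case: (p v).
Qed.

(** Minimisation is made total by letting the search also stop at [b v], which is the value [find]
    returns on failure. [RMu] looks for a zero, hence the negation of [P]. *)
Lemma computable_find k (P : nat -> seq nat -> bool) b :
  computable k.+1 (fun w => P (head 0 w) (behead w)) -> computable k b ->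
  computable k (fun v => find (fun i => P i v) (iota 0 (b v))).
Proof.
move=> cP cb.
have ch := @computable_head k.
have [r rP] := computable_andb (computable_negb cP)
  (computable_leq (computable_succ ch) (computable_weaken cb)).
exists (RMu r) => v sv; set t := find _ _.
have tb : t <= b v by have := find_size (P^~ v) (iota 0 (b v)); rewrite size_iota.
apply: ev_mu => [|m mt].
  have := rP (t :: v); rewrite /= sv => /(_ erefl).
  suff -> : ~~ P t v && (t < b v) = false by [].
  apply/negP => /andP[/negP nP tb']; apply: nP.
  have : has (P^~ v) (iota 0 (b v)) by rewrite has_find size_iota.
  by move/(nth_find 0); rewrite nth_iota.
exists 0; have := rP (m :: v); rewrite /= sv => /(_ erefl).
have mb := leq_trans mt tb; rewrite mb andbT.
suff -> : ~~ P m v by [].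
by have := before_find 0 mt; rewrite nth_iota //= add0n => ->.
Qed.

Lemma computable_has k (P : nat -> seq nat -> bool) b :
  computable k.+1 (fun w => P (head 0 w) (behead w)) -> computable k b ->
  computable k (fun v => has (fun i => P i v) (iota 0 (b v))).
Proof.
move=> cP cb; apply: computable_ext
  (computable_leq (computable_succ (computable_find cP cb)) cb) => v _.
by rewrite has_find size_iota.
Qed.

Lemma computable_all k (P : nat -> seq nat -> bool) b :
  computable k.+1 (fun w => P (head 0 w) (behead w)) -> computable k b ->
  computable k (fun v => all (fun i => P i v) (iota 0 (b v))).
Proof.
move=> cP cb; apply: computable_ext (computable_negb
  (computable_has (P := fun i v => ~~ P i v) (computable_negb cP) cb)) => v _.
by rewrite -[all _ _]negbK -has_predC.
Qed.

Create HintDb computable.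

(** A bounded quantifier prepends its variable to the argument list: known computable functions are
    weakened by one argument, and the variable itself is the head. *)
Ltac computable_under_binder :=
  repeat match goal with H : computable ?k _ |- computable (S ?k) _ =>
    apply computable_weaken in H end;
  match goal with |- computable (S ?k) _ => pose proof (@computable_head k) end;
  cbv beta in *.

#[export] Hint Resolve computable_const computable_succ computable_add
  computable_mul computable_exp computable_pred computable_sub computable_leq
  computable_negb computable_andb computable_orb computable_eq
  computable_if computable_ifb computable_head : computable.
#[export] Hint Extern 1 (computable _ (fun v => find _ (iota 0 _))) =>
  simple apply computable_find; [computable_under_binder|] : computable.
#[export] Hint Extern 1 (computable _ (fun v => nat_of_bool (has _ (iota 0 _)))) =>
  simple apply computable_has; [computable_under_binder|] : computable.
#[export] Hint Extern 1 (computable _ (fun v => nat_of_bool (all _ (iota 0 _)))) =>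
  simple apply computable_all; [computable_under_binder|] : computable.

Ltac computability := solve [auto 100 with computable].

Lemma computable_div k f g :
  computable k f -> computable k g -> computable k (fun v => f v %/ g v).
Proof.
move=> cf cg.
(* The quotient is the least [q] with [f v < q.+1 * g v], and it is at most [f v]. Division by 0 has
   value 0 and takes a branch of its own. *)
apply: (@computable_ext _ (fun v => if g v == 0 then 0 else
  find (fun q => f v < q.+1 * g v) (iota 0 (f v).+1))).
  move=> v _; case: eqP => [->|/eqP]; first by rewrite divn0.
  rewrite -lt0n => g0; set t := find _ _.
  have hs : has (fun q => f v < q.+1 * g v) (iota 0 (f v).+1).
    apply/hasP; exists (f v); first by rewrite mem_iota add0n ltnSn.
    by rewrite mulSn; nia.
  have tb : t < (f v).+1 by rewrite -[(f v).+1](size_iota 0) -has_find.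
  have := nth_find 0 hs; rewrite -/t nth_iota // add0n => ft.
  apply/eqP; rewrite eqn_leq -[_ %/ _ <= t]ltnS ltn_divLR // ft andbT.
  case: (posnP t) => [->//|t0].
  have tt : t.-1 < t by rewrite prednK.
  have := before_find 0 tt; rewrite nth_iota ?(ltn_trans tt) //= add0n prednK // => /negbT.
  by rewrite -leqNgt leq_divRL.
computability.
Qed.
#[export] Hint Resolve computable_div : computable.

Lemma computable_mod k f g :
  computable k f -> computable k g -> computable k (fun v => f v %% g v).
Proof.
move=> cf cg; apply: (@computable_ext _ (fun v => f v - f v %/ g v * g v)).
  by move=> v _; rewrite {1}(divn_eq (f v) (g v)) addKn.
computability.
Qed.
#[export] Hint Resolve computable_mod : computable.

Lemma computable_cpair k f g :
  computable k f -> computable k g -> computable k (fun v => cpair (f v) (g v)).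
Proof.
move=> cf cg; apply: (@computable_ext _
  (fun v => ((f v + g v) * (f v + g v).+1) %/ 2 + g v)).
  by move=> v _; rewrite /cpair divn2.
computability.
Qed.
#[export] Hint Resolve computable_cpair : computable.

(** * Decoding of pairs and words *)

(** The diagonal [x + y = s] starts at the triangular number of [s], and the offset [y] is at most
    [s], less than the gap [s + 1] to the next triangular number. *)
Lemma cpair_lt x y x' y' : x + y < x' + y' -> cpair x y < cpair x' y'.
Proof.
rewrite /cpair => lts.
have e s : (s * s.+1)./2.*2 = s * s.+1 by rewrite -[RHS]odd_double_half oddM /= andbN.
have := e (x + y); have := e (x' + y'); nia.
Qed.

Lemma cpair_inj x y x' y' : cpair x y = cpair x' y' -> x = x' /\ y = y'.
Proof.
move=> e; have es : x + y = x' + y'.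
  by case: (ltngtP (x + y) (x' + y')) => // /cpair_lt; rewrite e ltnn.
by move: e; rewrite /cpair es; lia.
Qed.

Lemma leq_cpairl x y : x <= cpair x y.
Proof.
have e s : (s * s.+1)./2.*2 = s * s.+1 by rewrite -[RHS]odd_double_half oddM /= andbN.
rewrite /cpair; have := e (x + y); nia.
Qed.

Lemma leq_cpairr x y : y <= cpair x y.
Proof. by rewrite /cpair leq_addl. Qed.

(** Both entries are bounded by the code, so a bounded search inverts [cpair] and is computable by
    [computable_find]. *)
Definition unpair1 (z : nat) : nat :=
  find (fun x => has (fun y => cpair x y == z) (iota 0 z.+1)) (iota 0 z.+1).

Definition unpair2 (z : nat) : nat :=
  find (fun y => has (fun x => cpair x y == z) (iota 0 z.+1)) (iota 0 z.+1).

Lemma find_iota (P : pred nat) b x :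
  x < b -> P x -> (forall y, P y -> y = x) -> find P (iota 0 b) = x.
Proof.
move=> xb Px Pu; have hs : has P (iota 0 b).
  by apply/hasP; exists x; rewrite // mem_iota.
have fb : find P (iota 0 b) < b by rewrite -{2}(size_iota 0 b) -has_find.
by apply: Pu; move: (nth_find 0 hs); rewrite nth_iota.
Qed.

Lemma cpairK1 x y : unpair1 (cpair x y) = x.
Proof.
apply: find_iota; first by rewrite ltnS leq_cpairl.
  by apply/hasP; exists y; rewrite // mem_iota ltnS leq_cpairr.
by move=> x' /hasP[y' _ /eqP/cpair_inj[]].
Qed.

Lemma cpairK2 x y : unpair2 (cpair x y) = y.
Proof.
apply: find_iota; first by rewrite ltnS leq_cpairr.
  by apply/hasP; exists x; rewrite // mem_iota ltnS leq_cpairl.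
by move=> y' /hasP[x' _ /eqP/cpair_inj[]].
Qed.

Lemma computable_unpair1 k f : computable k f -> computable k (fun v => unpair1 (f v)).
Proof. move=> cf; rewrite /unpair1; computability. Qed.

Lemma computable_unpair2 k f : computable k f -> computable k (fun v => unpair2 (f v)).
Proof. move=> cf; rewrite /unpair2; computability. Qed.
#[export] Hint Resolve computable_unpair1 computable_unpair2 : computable.

(** The predecessor removes the successor in [code_word]. As [cpair 0 0 = 0], the tail of the empty
    word, coded by 0, is again empty, so iterating past the end is harmless. *)
Definition wtail (u : nat) : nat := unpair2 u.-1.
Definition wnth (u k : nat) : nat := unpair1 (iter k wtail u).-1.
Definition wsize (u : nat) : nat :=
  find (fun i => iter i wtail u == 0) (iota 0 u.+1).

Lemma iter_wtail w i : iter i wtail (code_word w) = code_word (drop i w).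
Proof.
elim: i => [|i IH]; first by rewrite drop0.
rewrite iterS IH -[i.+1]add1n -drop_drop; case: (drop i w) => [|x s] /=.
  by rewrite /wtail /= -[0]/(cpair 0 0) cpairK2.
by rewrite /wtail /= cpairK2 drop0.
Qed.

Lemma wnth_code w i : i < size w -> wnth (code_word w) i = nth 0 w i.
Proof.
by move=> iw; rewrite /wnth iter_wtail (drop_nth 0 iw) /= cpairK1.
Qed.

Lemma wsize_code w : wsize (code_word w) = size w.
Proof.
have sw : size w <= code_word w.
  by elim: w => //= x w IH; rewrite ltnS (leq_trans IH) ?leq_cpairr.
set t := wsize _; have hs : has (fun i => iter i wtail (code_word w) == 0)
    (iota 0 (code_word w).+1).
  by apply/hasP; exists (size w); rewrite ?mem_iota ?ltnS // iter_wtail drop_size.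
have tb : t < (code_word w).+1.
  by rewrite -[X in _ < X](size_iota 0) -has_find.
have := nth_find 0 hs; rewrite -[find _ _]/t nth_iota // add0n iter_wtail.
case: (leqP (size w) t) => [wt _|tw]; last by rewrite (drop_nth 0 tw).
apply/eqP; rewrite eqn_leq wt andbT leqNgt; apply/negP => tw.
have := before_find 0 tw; rewrite nth_iota ?ltnS // add0n iter_wtail.
by rewrite drop_size.
Qed.

Lemma wnth_prefix p m i : i < m -> wnth (code_word (Defs.prefix p m)) i = p i.
Proof. by move=> im; rewrite wnth_code ?size_mkseq // nth_mkseq. Qed.

Lemma wsize_prefix p m : wsize (code_word (Defs.prefix p m)) = m.
Proof. by rewrite wsize_code size_mkseq. Qed.

Lemma computable_wtail : computable 1 (fun v => wtail (head 0 v)).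
Proof. rewrite /wtail; computability. Qed.

Lemma computable_wnth k f g :
  computable k f -> computable k g -> computable k (fun v => wnth (f v) (g v)).
Proof.
move=> cf cg; have := computable_iter computable_wtail cg cf.
rewrite /wnth; computability.
Qed.

Lemma computable_wsize k f : computable k f -> computable k (fun v => wsize (f v)).
Proof.
move=> cf; rewrite /wsize; apply: computable_find; last by computability.
apply: computable_eq; last by computability.
exact: computable_iter computable_wtail (@computable_head k) (computable_weaken cf).
Qed.
#[export] Hint Resolve computable_wnth computable_wsize : computable.

(** * Codes of rational numbers and of basic open sets *)

(** The second number is positive, so it bounds all common divisors and only finitely many
    candidates have to be tried. *)
Lemma computable_coprime k f g :
  computable k f -> computable k g -> computable k (fun v => coprime (f v) (g v).+1).
Proof.
move=> cf cg; apply: (@computable_ext _ (fun v => all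
  (fun d => ~~ ((f v %% d == 0) && ((g v).+1 %% d == 0)) || (d == 1)) (iota 0 (g v).+2))).
  move=> v _; congr nat_of_bool; apply/allP/idP => [H|cop d _].
    have := H (gcdn (f v) (g v).+1); rewrite mem_iota add0n /= ltnS.
    rewrite dvdn_leq ?dvdn_gcdr // => /(_ isT).
    by rewrite -!/(dvdn _ _) dvdn_gcdl dvdn_gcdr.
  rewrite -implybE; apply/implyP => /andP[df dg]; rewrite -dvdn1 -(eqP cop).
  by rewrite dvdn_gcd /dvdn df dg.
computability.
Qed.
#[export] Hint Resolve computable_coprime : computable.

(* A triple (s, a, d) codes a / (d + 1) if s = 0 and - (a + 1) / (d + 1) if not. *)
Definition rpos (x : nat) : nat := if unpair1 x == 0 then unpair1 (unpair2 x) else 0.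
Definition rneg (x : nat) : nat := if unpair1 x == 0 then 0 else (unpair1 (unpair2 x)).+1.
Definition rden (x : nat) : nat := (unpair2 (unpair2 x)).+1.
Definition rok (x : nat) : bool := coprime (rpos x + rneg x) (rden x).
Definition rdec (x : nat) : rat := (((rpos x)%:Z - (rneg x)%:Z)%:~R / (rden x)%:Z%:~R)%R.

(** [CodeSeq.code] on two-letter words, through which [pickle] encodes pairs. A sum is pickled as a
    pair of options, whose codes are [2 ^ x] for an entry of code [x] and 0 for [None]. The machine
    has to output pickled basic sets, so [pickle] is reproduced in arithmetic. *)
Definition code2 (a b : nat) : nat := 2 ^ a * (2 * 2 ^ b).+1.

Definition renc (x : nat) : nat :=
  code2 (if unpair1 x == 0 then code2 (2 ^ unpair1 (unpair2 x)) 0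
         else code2 0 (2 ^ unpair1 (unpair2 x)))
        (code2 (2 ^ rden x) 0).

Lemma code2E a b : CodeSeq.code [:: a; b] = code2 a b.
Proof. by rewrite /code2 /= muln1 mul2n. Qed.

Lemma pickle_pairE (T1 T2 : countType) (x : T1) (y : T2) :
  pickle (x, y) = code2 (pickle x) (pickle y).
Proof. by rewrite -code2E. Qed.

Lemma pickle_inlE (T1 T2 : countType) (x : T1) :
  pickle (inl x : T1 + T2) = code2 (2 ^ pickle x) 0.
Proof. by rewrite -[2 ^ pickle x]muln1 -code2E. Qed.

Lemma pickle_inrE (T1 T2 : countType) (x : T2) :
  pickle (inr x : T1 + T2) = code2 0 (2 ^ pickle x).
Proof. by rewrite -[2 ^ pickle x]muln1 -code2E. Qed.

Lemma pickle_PoszE n : pickle (Posz n) = code2 (2 ^ n) 0.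
Proof. exact: (pickle_inlE nat n). Qed.

Lemma pickle_NegzE n : pickle (Negz n) = code2 0 (2 ^ n).
Proof. exact: (pickle_inrE nat n). Qed.

Lemma absz_rnum x : absz ((rpos x)%:Z - (rneg x)%:Z)%R = rpos x + rneg x.
Proof. by rewrite /rpos /rneg; case: ifP => _; lia. Qed.

(** Coprimality makes the coded fraction reduced, so its numerator and denominator are the [numq]
    and [denq] that [pickle] encodes. *)
Lemma pickle_rdec x : rok x -> pickle (rdec x) = renc x.
Proof.
move=> cop; have cop' : coprime (absz ((rpos x)%:Z - (rneg x)%:Z)%R) (absz (rden x)).
  by rewrite absz_rnum.
change (pickle (numq (rdec x), denq (rdec x)) = renc x).
rewrite pickle_pairE /rdec coprimeq_num // coprimeq_den //= mul1r pickle_PoszE.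
rewrite /renc /rpos /rneg; case: ifP => _; congr code2.
  by rewrite subr0 pickle_PoszE.
by rewrite sub0r -NegzE pickle_NegzE.
Qed.

Lemma rdec_surj (q : rat) : exists2 x, rok x & rdec x = q.
Proof.
have dq : Posz (absz (denq q)).-1.+1 = denq q by have := denq_gt0 q; lia.
case nq : (numq q) => [a|a].
  exists (cpair 0 (cpair a (absz (denq q)).-1)).
    rewrite /rok /rpos /rneg /rden !(cpairK1, cpairK2) /= addn0.
    by have := coprime_num_den q; rewrite nq -dq.
  rewrite /rdec /rpos /rneg /rden !(cpairK1, cpairK2) /= dq subr0 -nq.
  exact: divq_num_den.
exists (cpair 1 (cpair a (absz (denq q)).-1)).
  rewrite /rok /rpos /rneg /rden !(cpairK1, cpairK2) /= add0n.
  by have := coprime_num_den q; rewrite nq -dq.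
rewrite /rdec /rpos /rneg /rden !(cpairK1, cpairK2) /= dq sub0r -NegzE -nq.
exact: divq_num_den.
Qed.

Lemma computable_rpos k f : computable k f -> computable k (fun v => rpos (f v)).
Proof. by move=> cf; rewrite /rpos; computability. Qed.
Lemma computable_rneg k f : computable k f -> computable k (fun v => rneg (f v)).
Proof. by move=> cf; rewrite /rneg; computability. Qed.
Lemma computable_rden k f : computable k f -> computable k (fun v => rden (f v)).
Proof. by move=> cf; rewrite /rden; computability. Qed.
#[export] Hint Resolve computable_rpos computable_rneg computable_rden : computable.

Lemma computable_rok k f : computable k f -> computable k (fun v => rok (f v)).
Proof.
by move=> cf; rewrite /rok /rden; apply: computable_coprime; computability.
Qed.

Lemma computable_code2 k f g :
  computable k f -> computable k g -> computable k (fun v => code2 (f v) (g v)).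
Proof. by move=> cf cg; rewrite /code2; computability. Qed.
#[export] Hint Resolve computable_rok computable_code2 : computable.

Lemma computable_renc k f : computable k f -> computable k (fun v => renc (f v)).
Proof. by move=> cf; rewrite /renc; computability. Qed.
#[export] Hint Resolve computable_renc : computable.

(* [rdec x <= (u - w) / M] and the reverse inequality, cleared of denominators. *)
Definition rle (x u w M : nat) : bool :=
  rpos x * M + rden x * w <= rden x * u + rneg x * M.
Definition rge (x u w M : nat) : bool :=
  rden x * u + rneg x * M <= rpos x * M + rden x * w.
Definition rlt (x y : nat) : bool :=
  rpos x * rden y + rneg y * rden x < rpos y * rden x + rneg x * rden y.

Definition bext (f : nat) : bool := unpair1 f != 0.
Definition bc1 (f : nat) : nat := unpair1 (unpair1 (unpair2 f)).
Definition bc2 (f : nat) : nat := unpair2 (unpair1 (unpair2 f)).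
Definition bc3 (f : nat) : nat := unpair1 (unpair2 (unpair2 f)).
Definition bc4 (f : nat) : nat := unpair2 (unpair2 (unpair2 f)).

Definition bok (f : nat) : bool :=
  if bext f then rok (bc1 f) && (rneg (bc1 f) < rpos (bc1 f)) else
  [&& rok (bc1 f), rok (bc2 f), rok (bc3 f), rok (bc4 f),
      rlt (bc1 f) (bc2 f) & rlt (bc3 f) (bc4 f)].

Definition bdec (f : nat) : basic :=
  if bext f then inr (rdec (bc1 f))
  else inl ((rdec (bc1 f), rdec (bc2 f)), (rdec (bc3 f), rdec (bc4 f))).

Definition benc (f : nat) : nat :=
  if bext f then code2 0 (2 ^ renc (bc1 f)) else
  code2 (2 ^ code2 (code2 (renc (bc1 f)) (renc (bc2 f)))
                   (code2 (renc (bc3 f)) (renc (bc4 f)))) 0.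

Lemma pickle_bdec f : bok f -> pickle (bdec f) = benc f.
Proof.
rewrite /bok /bdec /benc; case: ifP => _.
  by move=> /andP[ok _]; rewrite pickle_inrE pickle_rdec.
move=> /and5P[ok1 ok2 ok3 ok4 _].
by rewrite pickle_inlE !pickle_pairE !pickle_rdec.
Qed.

Lemma computable_rle k f g h l : computable k f -> computable k g ->
  computable k h -> computable k l ->
  computable k (fun v => rle (f v) (g v) (h v) (l v)).
Proof. by move=> *; rewrite /rle; computability. Qed.
Lemma computable_rge k f g h l : computable k f -> computable k g ->
  computable k h -> computable k l ->
  computable k (fun v => rge (f v) (g v) (h v) (l v)).
Proof. by move=> *; rewrite /rge; computability. Qed.
Lemma computable_rlt k f g : computable k f -> computable k g ->
  computable k (fun v => rlt (f v) (g v)).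
Proof. by move=> *; rewrite /rlt; computability. Qed.
Lemma computable_bext k f : computable k f -> computable k (fun v => bext (f v)).
Proof. by move=> *; rewrite /bext; computability. Qed.
Lemma computable_bc1 k f : computable k f -> computable k (fun v => bc1 (f v)).
Proof. by move=> *; rewrite /bc1; computability. Qed.
Lemma computable_bc2 k f : computable k f -> computable k (fun v => bc2 (f v)).
Proof. by move=> *; rewrite /bc2; computability. Qed.
Lemma computable_bc3 k f : computable k f -> computable k (fun v => bc3 (f v)).
Proof. by move=> *; rewrite /bc3; computability. Qed.
Lemma computable_bc4 k f : computable k f -> computable k (fun v => bc4 (f v)).
Proof. by move=> *; rewrite /bc4; computability. Qed.
#[export] Hint Resolve computable_rle computable_rge computable_rlt computable_bext
  computable_bc1 computable_bc2 computable_bc3 computable_bc4 : computable.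

Lemma computable_bok k f : computable k f -> computable k (fun v => bok (f v)).
Proof. by move=> *; rewrite /bok; computability. Qed.
Lemma computable_benc k f : computable k f -> computable k (fun v => benc (f v)).
Proof. by move=> *; rewrite /benc; computability. Qed.
#[export] Hint Resolve computable_bok computable_benc : computable.

Lemma rdec_lt x y : (rdec x < rdec y)%R = rlt x y.
Proof.
rewrite /rdec /rlt ltr_pdivrMr ?ltr0z // mulrAC ltr_pdivlMr ?ltr0z //.
rewrite -!intrM ltr_int; apply/idP/idP; lia.
Qed.

Lemma rdec_gt0 x : (0 < rdec x)%R = (rneg x < rpos x).
Proof.
by rewrite /rdec pmulr_lgt0 ?invr_gt0 ?ltr0z // subr_gt0.
Qed.

Lemma bdec_valid f : bok f -> basic_valid (bdec f).
Proof.
rewrite /bok /bdec; case: ifP => _ /=; first by rewrite rdec_gt0 => /andP[].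
by rewrite !rdec_lt => /and5P[_ _ _ _ /andP[-> ->]].
Qed.

Lemma bdec_surj b : basic_valid b -> exists2 f, bok f & bdec f = b.
Proof.
case: b => [[[a b] [c d]]|r] /=.
  have [x1 ok1 <-] := rdec_surj a; have [x2 ok2 <-] := rdec_surj b.
  have [x3 ok3 <-] := rdec_surj c; have [x4 ok4 <-] := rdec_surj d.
  rewrite !rdec_lt => -[ab cd]; exists (cpair 0 (cpair (cpair x1 x2) (cpair x3 x4))).
    rewrite /bok /bext /bc1 /bc2 /bc3 /bc4 !(cpairK1, cpairK2) /=.
    by rewrite ok1 ok2 ok3 ok4 ab cd.
  by rewrite /bdec /bext /bc1 /bc2 /bc3 /bc4 !(cpairK1, cpairK2).
have [x ok <-] := rdec_surj r; rewrite rdec_gt0 => x0.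
exists (cpair 1 (cpair (cpair x 0) 0)).
  by rewrite /bok /bext /bc1 !(cpairK1, cpairK2) /= ok.
by rewrite /bdec /bext /bc1 !(cpairK1, cpairK2).
Qed.

(** * The algorithm *)

(* [bin], [bavoid] and [bsub] compare the basic set coded by [f] with the open
   square of centre [((i - v) / M, (j - v) / M)] and half-side [1 / M]: it contains
   the square, its closure misses the square, it lies in the square. *)
Definition bin (f i j v M : nat) : bool :=
  if bext f then
    (rpos (bc1 f) * M) ^ 2 <
    rden (bc1 f) ^ 2 * (((i - v) + (v - i) - 1) ^ 2 + ((j - v) + (v - j) - 1) ^ 2)
  else [&& rle (bc1 f) i v.+1 M, rge (bc2 f) i.+1 v M,
           rle (bc3 f) j v.+1 M & rge (bc4 f) j.+1 v M].

Definition bavoid (f i j v M : nat) : bool :=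
  if bext f then
    rden (bc1 f) ^ 2 * (((i - v) + (v - i) + 1) ^ 2 + ((j - v) + (v - j) + 1) ^ 2)
    <= (rpos (bc1 f) * M) ^ 2
  else [|| rge (bc1 f) i.+1 v M, rle (bc2 f) i v.+1 M,
           rge (bc3 f) j.+1 v M | rle (bc4 f) j v.+1 M].

Definition bsub (f i j v M : nat) : bool :=
  ~~ bext f && [&& rge (bc1 f) i v.+1 M, rle (bc2 f) i.+1 v M,
                   rge (bc3 f) j v.+1 M & rle (bc4 f) j.+1 v M].

Definition listed (p : nat -> nat) (s f : nat) : bool :=
  has (fun k => p k == (benc f).+1) (iota 0 s).

Definition in_listed (p : nat -> nat) (s i j v M : nat) : bool :=
  has (fun f => [&& bok f, listed p s f & bin f i j v M]) (iota 0 s).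

Definition has_listed (p : nat -> nat) (s i j v M : nat) : bool :=
  has (fun f => [&& bok f, listed p s f & bsub f i j v M]) (iota 0 s).

(* A separation [t] is a grid of mesh [1 / mesh t] in the box of radius [box t],
   a labelling of the grid points by [0, ..., n], stored as the base [n + 1] digits
   of [labels t], and the length [stage t] of the prefixes of the names in use. *)
Definition box (t : nat) : nat := unpair1 t.
Definition mesh (t : nat) : nat := (unpair1 (unpair2 t)).+1.
Definition labels (t : nat) : nat := unpair1 (unpair2 (unpair2 t)).
Definition stage (t : nat) : nat := unpair2 (unpair2 (unpair2 t)).
Definition origin (t : nat) : nat := box t * mesh t.
Definition width (t : nat) : nat := 2 * origin t + 1.
Definition fine_width (t g : nat) : nat := 2 * (origin t * g.+1) + 1.
Definition lab (n t i j : nat) : nat :=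
  (labels t %/ n.+1 ^ (i * width t + j)) %% n.+1.

(** The bound on the stage limits the test to the first [t] symbols of the names. The second clause
    confines the complement of D to the box, by a listed exterior of radius at most [box t]. Indices
    that differ by at most 1 in both directions belong to overlapping squares, to which the fourth
    clause applies. *)
Definition separation (p1 p2 : nat -> nat) (n t : nat) : bool :=
  [&& stage t <= t,
      has (fun f => [&& bok f, listed p1 (stage t) f, bext f
                      & rle (bc1 f) (box t) 0 1]) (iota 0 (stage t)),
      all (fun i => all (fun j =>
        (lab n t i j != 0) || in_listed p1 (stage t) i j (origin t) (mesh t))
        (iota 0 (width t))) (iota 0 (width t)),
      all (fun i => all (fun j => all (fun i' => all (fun j' =>
        [|| lab n t i j == 0, lab n t i' j' == 0, i.+1 < i', i'.+1 < i,
            j.+1 < j', j'.+1 < j | lab n t i j == lab n t i' j'])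
        (iota 0 (width t))) (iota 0 (width t)))
        (iota 0 (width t))) (iota 0 (width t)) &
      all (fun l => has (fun i => has (fun j =>
        (lab n t i j == l.+1) && has_listed p2 (stage t) i j (origin t) (mesh t))
        (iota 0 (width t))) (iota 0 (width t))) (iota 0 n)].

(** Refinement divides the mesh by [g.+1]; a fine square takes its label from the coarse square
    whose indices are the quotients by [g.+1], which contains it by [square_refine]. *)
Definition open_test (p : nat -> nat) (n t l f g s : nat) : bool :=
  bok f && all (fun i => all (fun j =>
    [|| lab n t (i %/ g.+1) (j %/ g.+1) != l.+1,
        bavoid f i j (origin t * g.+1) (mesh t * g.+1)
      | in_listed p s i j (origin t * g.+1) (mesh t * g.+1)])
    (iota 0 (fine_width t g))) (iota 0 (fine_width t g)).

Definition boundary_test (p : nat -> nat) (n t l f g s : nat) : bool :=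
  bok f && has (fun i => has (fun j =>
    [&& lab n t (i %/ g.+1) (j %/ g.+1) == l.+1,
        bin f i j (origin t * g.+1) (mesh t * g.+1)
      & has_listed p s i j (origin t * g.+1) (mesh t * g.+1)])
    (iota 0 (fine_width t g))) (iota 0 (fine_width t g)).

Definition out_basic (k : nat) : nat := unpair1 (unpair2 k).
Definition out_refine (k : nat) : nat := unpair1 (unpair2 (unpair2 k)).
Definition out_stage (k : nat) : nat := unpair2 (unpair2 (unpair2 k)).

(** The index [k] packs the number of the stream, a basic set, a refinement and a stage. Even
    streams enumerate by [open_test], odd ones by [boundary_test]. *)
Definition out (p1 p2 : nat -> nat) (n t k : nat) : nat :=
  if (if unpair1 k %% 2 == 0
      then open_test p1 n t (unpair1 k %/ 2) (out_basic k) (out_refine k) (out_stage k)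
      else boundary_test p2 n t (unpair1 k %/ 2) (out_basic k) (out_refine k) (out_stage k))
  then (benc (out_basic k)).+1 else 0.

Definition first_separation (n u1 u2 : nat) : nat :=
  find (fun t => separation (wnth u1) (wnth u2) n t) (iota 0 (wsize u1)).

(** No answer is given until a separation is found below the prefix length ([find] returns that
    length on failure) and the prefix covers the stage that position [k] reads. *)
Definition machine (k n u1 u2 : nat) : nat :=
  if (first_separation n u1 u2 < wsize u1) && (out_stage k <= wsize u1)
  then (out (wnth u1) (wnth u2) n (first_separation n u1 u2) k).+1 else 0.

(** * Computability of the algorithm *)

Lemma computable_bin k f i j x y :
  computable k f -> computable k i -> computable k j -> computable k x ->
  computable k y ->
  computable k (fun v => bin (f v) (i v) (j v) (x v) (y v)).
Proof. by move=> *; rewrite /bin; computability. Qed.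

Lemma computable_bavoid k f i j x y :
  computable k f -> computable k i -> computable k j -> computable k x ->
  computable k y ->
  computable k (fun v => bavoid (f v) (i v) (j v) (x v) (y v)).
Proof. by move=> *; rewrite /bavoid; computability. Qed.

Lemma computable_bsub k f i j x y :
  computable k f -> computable k i -> computable k j -> computable k x ->
  computable k y ->
  computable k (fun v => bsub (f v) (i v) (j v) (x v) (y v)).
Proof. by move=> *; rewrite /bsub; computability. Qed.

Lemma computable_listed k u s f :
  computable k u -> computable k s -> computable k f ->
  computable k (fun v => listed (wnth (u v)) (s v) (f v)).
Proof. by move=> *; rewrite /listed; computability. Qed.

Lemma computable_lab k n t i j :
  computable k n -> computable k t -> computable k i -> computable k j ->
  computable k (fun v => lab (n v) (t v) (i v) (j v)).
Proof. by move=> *; rewrite /lab /width /origin /labels /mesh /box; computability. Qed.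

Lemma computable_stage k t :
  computable k t ->
  computable k (fun v => stage (t v)).
Proof. by move=> *; rewrite /stage; computability. Qed.

Lemma computable_box k t :
  computable k t ->
  computable k (fun v => box (t v)).
Proof. by move=> *; rewrite /box; computability. Qed.

Lemma computable_mesh k t :
  computable k t ->
  computable k (fun v => mesh (t v)).
Proof. by move=> *; rewrite /mesh; computability. Qed.

Lemma computable_origin k t :
  computable k t ->
  computable k (fun v => origin (t v)).
Proof. by move=> *; rewrite /origin /box /mesh; computability. Qed.

#[export] Hint Resolve computable_bin computable_bavoid computable_bsub computable_listed
  computable_lab computable_stage computable_box computable_mesh computable_origin
  : computable.

Lemma computable_in_listed k u s i j x y :
  computable k u -> computable k s -> computable k i -> computable k j ->
  computable k x -> computable k y ->
  computable k (fun v => in_listed (wnth (u v)) (s v) (i v) (j v) (x v) (y v)).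
Proof. by move=> *; rewrite /in_listed; computability. Qed.

Lemma computable_has_listed k u s i j x y :
  computable k u -> computable k s -> computable k i -> computable k j ->
  computable k x -> computable k y ->
  computable k (fun v => has_listed (wnth (u v)) (s v) (i v) (j v) (x v) (y v)).
Proof. by move=> *; rewrite /has_listed; computability. Qed.

#[export] Hint Resolve computable_in_listed computable_has_listed : computable.

Lemma computable_separation k n u u' t : computable k n -> computable k u ->
  computable k u' -> computable k t ->
  computable k (fun v => separation (wnth (u v)) (wnth (u' v)) (n v) (t v)).
Proof. by move=> *; rewrite /separation /width; computability. Qed.

Lemma computable_open_test k n u t l f g s : computable k n -> computable k u ->
  computable k t -> computable k l -> computable k f -> computable k g ->
  computable k s ->
  computable k (fun v => open_test (wnth (u v)) (n v) (t v) (l v) (f v) (g v) (s v)).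
Proof. by move=> *; rewrite /open_test /fine_width; computability. Qed.

Lemma computable_boundary_test k n u t l f g s : computable k n -> computable k u ->
  computable k t -> computable k l -> computable k f -> computable k g ->
  computable k s ->
  computable k (fun v => boundary_test (wnth (u v)) (n v) (t v) (l v) (f v) (g v) (s v)).
Proof. by move=> *; rewrite /boundary_test /fine_width; computability. Qed.
#[export] Hint Resolve computable_separation computable_open_test
  computable_boundary_test : computable.

Lemma computable_machine : computable 4
  (fun v => machine (nth 0 v 0) (nth 0 v 1) (nth 0 v 2) (nth 0 v 3)).
Proof.
have c0 := @computable_nth 4 0 isT; have c1 := @computable_nth 4 1 isT.
have c2 := @computable_nth 4 2 isT; have c3 := @computable_nth 4 3 isT.
have cfirst : computable 4
    (fun v => first_separation (nth 0 v 1) (nth 0 v 2) (nth 0 v 3)).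
  by rewrite /first_separation; computability.
by rewrite /machine /out /out_basic /out_refine /out_stage; computability.
Qed.

(** * Stability under longer prefixes, and the machine *)

Section Prefixes.
Variables (p p' : nat -> nat) (s : nat).
Hypothesis pp' : forall k, k < s -> p k = p' k.

Lemma eq_listed f : listed p s f = listed p' s f.
Proof. by apply: eq_in_has => k; rewrite mem_iota => /andP[_ ks]; rewrite pp'. Qed.

Lemma eq_in_listed i j v M : in_listed p s i j v M = in_listed p' s i j v M.
Proof. by apply: eq_has => f; rewrite eq_listed. Qed.

Lemma eq_has_listed i j v M : has_listed p s i j v M = has_listed p' s i j v M.
Proof. by apply: eq_has => f; rewrite eq_listed. Qed.
End Prefixes.

Lemma eq_separation p1 p1' p2 p2' n t :
  (forall k, k < t -> p1 k = p1' k) -> (forall k, k < t -> p2 k = p2' k) ->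
  separation p1 p2 n t = separation p1' p2' n t.
Proof.
move=> e1 e2; rewrite /separation; case: (leqP (stage t) t) => //= st.
have {}e1 k : k < stage t -> p1 k = p1' k by move=> /leq_trans/(_ st)/e1.
have {}e2 k : k < stage t -> p2 k = p2' k by move=> /leq_trans/(_ st)/e2.
congr [&& _, _, _ & _].
- by apply: eq_has => f; rewrite (eq_listed e1).
- by apply: eq_all => i /=; apply: eq_all => j /=; rewrite (eq_in_listed e1).
- apply: eq_all => l /=; apply: eq_has => i /=; apply: eq_has => j /=.
  by rewrite (eq_has_listed e2).
Qed.

Lemma eq_out p1 p1' p2 p2' n t k :
  (forall i, i < out_stage k -> p1 i = p1' i) ->
  (forall i, i < out_stage k -> p2 i = p2' i) ->
  out p1 p2 n t k = out p1' p2' n t k.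
Proof.
move=> e1 e2; rewrite /out /open_test /boundary_test.
congr (if (if _ then _ && _ else _ && _) then _ else _).
  by apply: eq_all => i /=; apply: eq_all => j /=; rewrite (eq_in_listed e1).
by apply: eq_has => i /=; apply: eq_has => j /=; rewrite (eq_has_listed e2).
Qed.

(** Determinism shows that the machine never gives a second answer. For [RMu], the smaller of two
    results would be both a zero and a point where the value is a successor. *)
Fixpoint rf_eval_det r v y (H : rf_eval r v y) {struct H} :
  forall y', rf_eval r v y' -> y = y'
with rf_evals_det rs v ys (H : rf_evals rs v ys) {struct H} :
  forall ys', rf_evals rs v ys' -> ys = ys'.
Proof.
- case: H => {r v y}.
  + by move=> v y' H'; inversion H'.
  + by move=> x v y' H'; inversion H'.
  + by move=> i v _ y' H'; inversion H'.
  + move=> f gs v ys y Hs Hy y' H'; inversion H' as [| | |? ? ? ys' ? Hs' Hy'| | |]; subst.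
    by move: Hy'; rewrite -(rf_evals_det _ _ _ Hs _ Hs') => /(rf_eval_det _ _ _ Hy).
  + move=> f g v y Hy y' H'; inversion H' as [| | | |? ? ? ? Hy'| |]; subst.
    exact: rf_eval_det _ _ _ Hy _ Hy'.
  + move=> f g k v r y Hr Hy y' H'; inversion H' as [| | | | |? ? ? ? r' ? Hr' Hy'|]; subst.
    by move: Hy'; rewrite -(rf_eval_det _ _ _ Hr _ Hr') => /(rf_eval_det _ _ _ Hy).
  + move=> f v k Hk Hm y' H'; inversion H' as [| | | | | |? ? ? Hk' Hm']; subst.
    case: (ltngtP k y') => // lt.
      by destruct (Hm' _ lt) as [r Hr]; discriminate (rf_eval_det _ _ _ Hk _ Hr).
    by destruct (Hm _ lt) as [r Hr]; discriminate (rf_eval_det _ _ _ Hr _ Hk').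
- case: H => {rs v ys}.
  + by move=> v ys' H'; inversion H'.
  + move=> g gs v y ys Hy Hs ys' H'; inversion H' as [|? ? ? y1 ys1 Hy1 Hs1]; subst.
    by rewrite (rf_eval_det _ _ _ Hy _ Hy1) (rf_evals_det _ _ _ Hs _ Hs1).
Qed.

Lemma machine_exists : exists M, rf_total4 M /\
  forall n p1 p2, (exists t, separation p1 p2 n t) ->
  exists2 t, separation p1 p2 n t & machine_computes M n p1 p2 (out p1 p2 n t).
Proof.
have [M MP] := computable_machine; exists M.
have ME a b c d := MP [:: a; b; c; d] erefl.
split=> [a b c d|n p1 p2 ext]; first by exists (machine a b c d); apply: ME.
case: (ex_minnP ext) => t0 sep0 min0; exists t0 => //.
(* For [t < m] the prefixes decide the test as the full names do. The bounded search thus returns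
   [t0] as soon as [t0 < m], and its failure value [m] before that. *)
have first m : first_separation n (code_word (Defs.prefix p1 m))
    (code_word (Defs.prefix p2 m)) = if t0 < m then t0 else m.
  rewrite /first_separation wsize_prefix.
  have E t : t < m -> separation (wnth (code_word (Defs.prefix p1 m)))
      (wnth (code_word (Defs.prefix p2 m))) n t = separation p1 p2 n t.
    move=> tm; apply: eq_separation => k kt; rewrite wnth_prefix //; exact: ltn_trans tm.
  rewrite (@eq_in_find _ _ (separation p1 p2 n)); last first.
    by move=> t; rewrite mem_iota => /andP[_]; apply: E.
  set F := find _ _; case: ltnP => t0m.
    have hs : has (separation p1 p2 n) (iota 0 m).
      by apply/hasP; exists t0; rewrite ?mem_iota.
    have Fm : F < m by rewrite -[X in _ < X](size_iota 0 m) -has_find.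
    have := nth_find 0 hs; rewrite nth_iota // add0n => /min0 t0F.
    apply/eqP; rewrite eqn_leq t0F andbT leqNgt; apply/negP => ltF.
    by have := before_find 0 ltF; rewrite nth_iota // add0n sep0.
  rewrite /F hasNfind ?size_iota //; apply/hasPn => t; rewrite mem_iota => /andP[_ tm].
  by apply/negP => /min0; rewrite leqNgt (leq_trans tm).
have mach k m : machine k n (code_word (Defs.prefix p1 m)) (code_word (Defs.prefix p2 m))
    = if (t0 < m) && (out_stage k <= m) then (out p1 p2 n t0 k).+1 else 0.
  rewrite /machine first wsize_prefix; case: (ltnP t0 m) => [->|_]; last by rewrite ltnn.
  case: (leqP (out_stage k) m) => //= km; congr S.
  by apply: eq_out => i ik; rewrite wnth_prefix // (leq_trans ik).
split=> [k|k m v].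
  exists (maxn t0.+1 (out_stage k)); set m := maxn _ _.
  have := ME k n (code_word (Defs.prefix p1 m)) (code_word (Defs.prefix p2 m)).
  by rewrite /= mach leq_maxl leq_maxr.
by move=> /(rf_eval_det (ME _ _ _ _)); rewrite /= mach; case: ifP => // _ [].
Qed.

(** * Squares and basic open sets *)

Local Open Scope ring_scope.

(** Stated over any field: at [rat] it gives the vertices of [square], at [R] the grid points, and
    [ratr_gridq] relates the two. *)
Definition gridq (F : numFieldType) (u w M : nat) : F := (u%:R - w%:R) / M%:R.

Definition square (i j v M : nat) : basic :=
  inl ((gridq _ i v.+1 M, gridq _ i.+1 v M), (gridq _ j v.+1 M, gridq _ j.+1 v M)).

Section Geometry.
Variable R : realType.
Implicit Types (x y e r : R) (z : Chat R) (b : basic).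

(** Balls of the maximum norm: they are squares parallel to the grid, and are compared with grid
    squares one coordinate at a time. *)
Definition ball x y e : cset R := fun z =>
  if z is Some (x', y') then `|x' - x| < e /\ `|y' - y| < e else False.

Lemma ratr_gridq u w M : ratr (gridq rat u w M) = gridq R u w M.
Proof. by rewrite /gridq fmorph_div rmorphB /= !ratr_nat. Qed.

Lemma gridqSr u w M : gridq R u w.+1 M = gridq R u w M - M%:R^-1.
Proof. by rewrite /gridq -natr1 opprD addrA mulrBl mul1r. Qed.

Lemma gridqSl u w M : gridq R u.+1 w M = gridq R u w M + M%:R^-1.
Proof. by rewrite /gridq -natr1 addrAC mulrDl mul1r. Qed.

Lemma ratr_rdec c : ratr (rdec c) = ((rpos c)%:R - (rneg c)%:R) / (rden c)%:R :> R.
Proof.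
by rewrite /rdec fmorph_div /= !ratr_int rmorphB /= -!pmulrn.
Qed.

Lemma rleE c u w M : (0 < M)%N -> rle c u w M = (ratr (rdec c) <= gridq R u w M).
Proof.
move=> M0; have M0' : 0 < M%:R :> R by rewrite ltr0n.
have d0 : 0 < (rden c)%:R :> R by rewrite ltr0n.
rewrite /rle ratr_rdec /gridq; move: (rden c) d0 => d d0.
rewrite -(ler_nat R) !natrD !natrM.
rewrite ler_pdivrMr // mulrAC ler_pdivlMr //.
by apply/idP/idP; lra.
Qed.

Lemma rgeE c u w M : (0 < M)%N -> rge c u w M = (gridq R u w M <= ratr (rdec c)).
Proof.
move=> M0; have M0' : 0 < M%:R :> R by rewrite ltr0n.
have d0 : 0 < (rden c)%:R :> R by rewrite ltr0n.
rewrite /rge ratr_rdec /gridq; move: (rden c) d0 => d d0.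
rewrite -(ler_nat R) !natrD !natrM.
rewrite ler_pdivlMr // mulrAC ler_pdivrMr //.
by apply/idP/idP; lra.
Qed.

Lemma square_Some i j v M x y : (0 < M)%N -> in_basic (square i j v M) (Some (x, y)) <->
  (`|x * M%:R - (i%:R - v%:R)| < 1 /\ `|y * M%:R - (j%:R - v%:R)| < 1).
Proof.
move=> M0; rewrite /= !ratr_gridq /gridq.
have M0' : 0 < M%:R :> R by rewrite ltr0n.
rewrite !ltr_pdivrMr // !ltr_pdivlMr // !ltr_norml !ltrBlDr !ltrBrDr.
rewrite -!natr1.
by split=> [[? [? [? ?]]]|[/andP[? ?] /andP[? ?]]]; repeat split; try (apply/andP; split); lra.
Qed.

Lemma ratr_rdec_sqr c : (rneg c < rpos c)%N ->
  ratr (rdec c) ^+ 2 = (rpos c)%:R ^+ 2 / (rden c)%:R ^+ 2 :> R.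
Proof.
rewrite ratr_rdec /rpos /rneg; case: ifP => _ // _.
by rewrite subr0 expr_div_n.
Qed.

Lemma natr_dist (i v : nat) : ((i - v) + (v - i))%N%:R = `|i%:R - v%:R| :> R.
Proof.
case: (leqP i v) => [iv|/ltnW vi].
  by rewrite (eqP iv) add0n natrB // ler0_norm ?opprB // subr_le0 ler_nat.
by rewrite (eqP vi) addn0 natrB // ger0_norm // subr_ge0 ler_nat.
Qed.

(** The truncated subtraction in [bin] is intended: if [i] and [v] differ by at most 1, the closed
    interval of radius 1 about [i - v] contains 0, and the least absolute value on it is 0. *)
Lemma natr_pred_max (d : nat) : (d - 1)%N%:R = Num.max 0 (d%:R - 1) :> R.
Proof.
case: d => [|d]; first by rewrite max_l // sub0r oppr_le0 ler01.
by rewrite subn1 -natr1 addrK max_r.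
Qed.

Lemma sqr_dist_lb (i v : nat) x : `|x - (i%:R - v%:R)| < 1 ->
  ((i - v) + (v - i) - 1)%N%:R ^+ 2 <= x ^+ 2.
Proof.
move=> h; rewrite natr_pred_max natr_dist -[x ^+ 2]real_normK ?num_real //.
rewrite ler_sqr ?nnegrE ?le_max ?lexx // ge_max normr_ge0 /=.
have := ler_distD x (i%:R - v%:R) 0; rewrite !subr0 distrC; lra.
Qed.

Lemma sqr_dist_ub (i v : nat) x : `|x - (i%:R - v%:R)| < 1 ->
  x ^+ 2 < ((i - v) + (v - i) + 1)%N%:R ^+ 2.
Proof.
move=> h; rewrite natrD natr_dist -[x ^+ 2]real_normK ?num_real //.
rewrite ltr_sqr ?nnegrE ?addr_ge0 ?normr_ge0 //.
have := ler_distD (i%:R - v%:R) x 0; rewrite !subr0; lra.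
Qed.

(** The extrema are attained on the closed interval. The completeness of the tests for exteriors
    follows by evaluating the hypothesis at such extremal points. *)
Lemma sqr_dist_lb_attained (i v : nat) : exists2 x : R, `|x - (i%:R - v%:R)| <= 1 &
  x ^+ 2 = ((i - v) + (v - i) - 1)%N%:R ^+ 2.
Proof.
have [vi|iv] := leqP v i.
  exists ((i - v) - 1)%N%:R; last by rewrite (eqP vi) addn0.
  rewrite natr_pred_max natrB //; set d := i%:R - v%:R.
  have : 0 <= d :> R by rewrite subr_ge0 ler_nat.
  by rewrite ler_norml /Num.max; case: ifP; lra.
exists (- ((v - i) - 1)%N%:R); last by rewrite sqrrN (eqP (ltnW iv)) add0n.
rewrite natr_pred_max natrB ?(ltnW iv) // -[i%:R - _]opprB; set d := v%:R - i%:R.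
have : 0 <= d :> R by rewrite subr_ge0 ler_nat ltnW.
by rewrite ler_norml /Num.max; case: ifP; lra.
Qed.

Lemma sqr_dist_ub_attained (i v : nat) : exists2 x : R, `|x - (i%:R - v%:R)| <= 1 &
  x ^+ 2 = ((i - v) + (v - i) + 1)%N%:R ^+ 2.
Proof.
have [vi|iv] := leqP v i.
  exists ((i - v) + 1)%N%:R; last by rewrite (eqP vi) addn0.
  by rewrite natrD natrB // ler_norml; lra.
exists (- ((v - i) + 1)%N%:R); last by rewrite sqrrN (eqP (ltnW iv)) add0n.
by rewrite natrD natrB ?(ltnW iv) // ler_norml; lra.
Qed.

(** Used coordinatewise: if a rectangle passes none of the four tests in [bavoid], its closure has a
    point near the centre of the square. *)
Lemma clip_itv (a b c d : R) : 0 < d -> a < b -> a < c + d -> c - d < b ->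
  exists2 x, a <= x <= b & `|x - c| < 2 * d.
Proof.
move=> d0 ab ac cb; exists (Num.max a (c - d)).
  by rewrite le_max lexx ge_max (ltW ab) (ltW cb).
by rewrite ltr_norml /Num.max; case: ifP => ?; lra.
Qed.

Section Tests.
Variables (f i j v M : nat).
Hypotheses (M_gt0 : (0 < M)%N) (okf : bok f).

Let MR : 0 < M%:R :> R. Proof. by rewrite ltr0n. Qed.

Let ext_pos : bext f -> (rneg (bc1 f) < rpos (bc1 f))%N.
Proof. by move=> ef; have := bdec_valid okf; rewrite /bdec ef /= rdec_gt0. Qed.

Let den_gt0 : 0 < (rden (bc1 f))%:R ^+ 2 :> R.
Proof. by rewrite exprn_gt0 // ltr0n. Qed.

Lemma bin_sound z : bin f i j v M -> in_basic (square i j v M) z -> in_basic (bdec f) z.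
Proof.
case: z => [[x y]|] //; rewrite /bin; case ef: (bext f).
  move=> h /(square_Some _ _ _ _ _ M_gt0)[/sqr_dist_lb hx /sqr_dist_lb hy].
  rewrite /bdec ef /= ratr_rdec_sqr ?ext_pos // ltr_pdivrMr //.
  move: h; rewrite -(ltr_nat R) !natrX !natrM !natrD !natrX exprMn => h.
  rewrite !exprMn in hx hy.
  rewrite -(ltr_pM2r (exprn_gt0 2 MR)); apply: lt_le_trans h _.
  rewrite [X in _ <= X](_ : _ = (rden (bc1 f))%:R ^+ 2 *
    (x ^+ 2 * M%:R ^+ 2 + y ^+ 2 * M%:R ^+ 2)); last by move: (rden _) => d; ring.
  by rewrite ler_pM2l // lerD.
rewrite !rleE // !rgeE // /bdec ef /= !ratr_gridq => /and4P[h1 h2 h3 h4] [k1 [k2 [k3 k4]]].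
split; [exact: le_lt_trans h1 k1|split; [exact: lt_le_trans k2 h2|]].
by split; [exact: le_lt_trans h3 k3|exact: lt_le_trans k4 h4].
Qed.

Lemma bavoid_sound z :
  bavoid f i j v M -> in_basic (square i j v M) z -> ~ in_basic_cl (bdec f) z.
Proof.
case: z => [[x y]|] //; rewrite /bavoid; case ef: (bext f).
  move=> h /(square_Some _ _ _ _ _ M_gt0)[/sqr_dist_ub hx /sqr_dist_ub hy].
  rewrite /bdec ef /= ratr_rdec_sqr ?ext_pos // ler_pdivrMr //.
  move: h; rewrite -(ler_nat R) !natrX !natrM !natrD !natrX exprMn => h.
  rewrite !exprMn in hx hy; apply/negP.
  rewrite -ltNge -(ltr_pM2r (exprn_gt0 2 MR)); apply: lt_le_trans h.
  rewrite [X in X < _](_ : _ = (rden (bc1 f))%:R ^+ 2 *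
    (x ^+ 2 * M%:R ^+ 2 + y ^+ 2 * M%:R ^+ 2)); last by move: (rden _) => d; ring.
  by rewrite ltr_pM2l // ltrD.
rewrite !rleE // !rgeE // /bdec ef /= !ratr_gridq => h [k1 [k2 [k3 k4]]] [l1 [l2 [l3 l4]]].
case/or4P: h => h.
- by have := lt_le_trans k2 (le_trans h l1); rewrite ltxx.
- by have := lt_le_trans k1 (le_trans l2 h); rewrite ltxx.
- by have := lt_le_trans k4 (le_trans h l3); rewrite ltxx.
- by have := lt_le_trans k3 (le_trans l4 h); rewrite ltxx.
Qed.

Lemma bsub_sound z : bsub f i j v M -> in_basic (bdec f) z -> in_basic (square i j v M) z.
Proof.
case: z => [[x y]|]; rewrite /bsub /bdec; case: ifP => //= _.
rewrite !rleE // !rgeE // !ratr_gridq => /and4P[h1 h2 h3 h4] [k1 [k2 [k3 k4]]].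
split; [exact: le_lt_trans h1 k1|split; [exact: lt_le_trans k2 h2|]].
by split; [exact: le_lt_trans h3 k3|exact: lt_le_trans k4 h4].
Qed.

(** Radius [2 / M] puts the closed square of half-side [1 / M] inside the open ball. Here [x] and
    [y] are coordinates scaled by [M]. *)
Lemma ball_grid (x y : R) : `|x - (i%:R - v%:R)| <= 1 -> `|y - (j%:R - v%:R)| <= 1 ->
  ball (gridq R i v M) (gridq R j v M) (2 / M%:R) (Some (x / M%:R, y / M%:R)).
Proof.
move=> hx hy /=; rewrite /gridq -!mulrBl !normrM !normfV !(gtr0_norm MR).
by rewrite !ltr_pM2r ?invr_gt0 //; split; lra.
Qed.

Lemma bin_complete :
  (forall z, ball (gridq R i v M) (gridq R j v M) (2 / M%:R) z -> in_basic (bdec f) z) ->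
  bin f i j v M.
Proof.
move=> hb; rewrite /bin; case ef: (bext f).
  have [x xle xE] := sqr_dist_lb_attained i v.
  have [y yle yE] := sqr_dist_lb_attained j v.
  have := hb _ (ball_grid xle yle).
  rewrite /bdec ef /= ratr_rdec_sqr ?ext_pos // !expr_div_n xE yE -mulrDl.
  rewrite ltr_pdivrMr // mulrAC ltr_pdivlMr ?exprn_gt0 //.
  by rewrite -(ltr_nat R) !natrX !natrM !natrD !natrX exprMn [_ ^+ 2 * (_ + _)]mulrC.
have h1 : `|(i%:R - v%:R - 1) - (i%:R - v%:R)| <= 1 :> R by rewrite ler_norml; lra.
have h2 : `|(i%:R - v%:R + 1) - (i%:R - v%:R)| <= 1 :> R by rewrite ler_norml; lra.
have h3 : `|(j%:R - v%:R - 1) - (j%:R - v%:R)| <= 1 :> R by rewrite ler_norml; lra.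
have h4 : `|(j%:R - v%:R + 1) - (j%:R - v%:R)| <= 1 :> R by rewrite ler_norml; lra.
(* Two opposite corners of the closed square yield all four inequalities. *)
have := hb _ (ball_grid h1 h3); have := hb _ (ball_grid h2 h4).
rewrite !rleE // !rgeE // /bdec ef /= /gridq -!natr1 => -[? [k2 [? k4]]] [k1 [? [k3 ?]]].
have e1 (a b : R) : a - (b + 1) = a - b - 1 by ring.
have e2 (a b : R) : a + 1 - b = a - b + 1 by ring.
by rewrite !e1 !e2 (ltW k1) (ltW k2) (ltW k3) (ltW k4).
Qed.

Lemma bavoid_complete :
  (forall z, ball (gridq R i v M) (gridq R j v M) (2 / M%:R) z -> ~ in_basic_cl (bdec f) z) ->
  bavoid f i j v M.
Proof.
move=> hb; rewrite /bavoid; case ef: (bext f).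
  have [x xle xE] := sqr_dist_ub_attained i v.
  have [y yle yE] := sqr_dist_ub_attained j v.
  have := hb _ (ball_grid xle yle).
  rewrite /bdec ef /= ratr_rdec_sqr ?ext_pos // !expr_div_n xE yE -mulrDl.
  move/negP; rewrite -ltNge ltr_pdivlMr // mulrAC ltr_pdivrMr ?exprn_gt0 // => /ltW.
  by rewrite -!natrX -natrD -!natrM ler_nat expnMn mulnC.
rewrite !rleE // !rgeE //; apply/negPn/negP.
rewrite !negb_or -!ltNge => /and4P[h1 h2 h3 h4].
have := bdec_valid okf; rewrite /bdec ef /= -!(ltr_rat R) => -[ab cd].
have M1 : 0 < M%:R^-1 :> R by rewrite invr_gt0.
rewrite !gridqSr !gridqSl in h1 h2 h3 h4.
have [x /andP[x1 x2] xb] := clip_itv M1 ab h1 h2.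
have [y /andP[y1 y2] yb] := clip_itv M1 cd h3 h4.
by apply: (hb (Some (x, y))); rewrite // /bdec ef.
Qed.

Lemma bin_square : bdec f = square i j v M -> bin f i j v M.
Proof.
rewrite /bdec /bin; case: ifP => // _ [e1 e2 e3 e4].
by rewrite !rleE // !rgeE // e1 e2 e3 e4 !ratr_gridq !lexx.
Qed.

Lemma bsub_square : bdec f = square i j v M -> bsub f i j v M.
Proof.
rewrite /bdec /bsub; case: ifP => // _ [e1 e2 e3 e4].
by rewrite !rleE // !rgeE // e1 e2 e3 e4 !ratr_gridq !lexx.
Qed.
End Tests.
End Geometry.

(** * Topology of the sphere *)

Section Topology.
Variable R : realType.
Implicit Types (x y e r : R) (z : Chat R) (b : basic) (S T U : cset R).

(** Compactness by a supremum: consider the [t] for which one [e] serves all of the interval from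
    [a] to [t]. The local radius at their supremum carries such a [t] past it, unless the supremum
    is [b]. *)
Lemma lebesgue_number1 (Q : R -> R -> Prop) (a b : R) :
  a <= b -> (forall x e e', e' <= e -> Q x e -> Q x e') ->
  (forall x, a <= x <= b -> exists2 e, 0 < e & forall x', `|x' - x| < e -> Q x' e) ->
  exists2 e, 0 < e & forall x, a <= x <= b -> Q x e.
Proof.
move=> ab Qle Qloc.
pose E := (fun t => a <= t <= b /\ exists2 e, 0 < e & forall x, a <= x <= t -> Q x e) : R -> Prop.
have Ea : E a.
  split; first by rewrite lexx.
  have [|e e0 eQ] := Qloc a; first by rewrite lexx.
  exists e => // x; rewrite -eq_le => /eqP <-; apply: eQ; by rewrite subrr normr0.
have supE : has_sup E by split; [exists a|exists b => t [/andP[]]].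
have sE t : E t -> t <= sup E by move=> Et; apply: (sup_upper_bound supE).
have sab : a <= sup E <= b.
  by rewrite sE //; apply: ge_sup; [exists a|move=> t [/andP[]]].
have [e0 e0_gt0 e0Q] := Qloc _ sab.
have [t [tab [e e_gt0 eQ]] te] := sup_adherent e0_gt0 supE.
(* Being in [E], this point is at most the supremum, which is possible only if it is [b]. *)
pose t' := Num.min b (sup E + e0 / 2).
have Et' : E t'.
  split; first by rewrite ge_min lexx /= le_min ab /=; move: sab => /andP[? ?]; lra.
  exists (Num.min e e0); first by rewrite lt_min e_gt0.
  move=> x /andP[ax]; rewrite le_min => /andP[xb xs].
  have [xt|tx] := leP x t; first by apply: Qle (eQ x _); rewrite ?ge_min ?lexx ?ax.
  apply: Qle (e0Q x _); first by rewrite ge_min lexx orbT.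
  by rewrite ltr_norml; lra.
have := sE _ Et'; rewrite ge_min => /orP[bs|]; last by lra.
have bE : t' = b.
  by rewrite /t' min_l //; move: sab => /andP[? ?]; lra.
by move: Et' => [_]; rewrite bE.
Qed.

(** A tube argument: compactness in [y] gives one radius for a whole vertical strip around [x], and
    compactness in [x] then gives one for the square. *)
Lemma lebesgue_number2 (Q : R -> R -> R -> Prop) (a b : R) :
  a <= b -> (forall x y e e', e' <= e -> Q x y e -> Q x y e') ->
  (forall x y, a <= x <= b -> a <= y <= b -> exists2 e, 0 < e &
     forall x' y', `|x' - x| < e -> `|y' - y| < e -> Q x' y' e) ->
  exists2 e, 0 < e & forall x y, a <= x <= b -> a <= y <= b -> Q x y e.
Proof.
move=> ab Qle Qloc.
have [||e e0 eQ] := @lebesgue_number1 (fun x e => forall y, a <= y <= b -> Q x y e) a b ab.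
- by move=> x e e' ee' H y yab; apply: Qle ee' (H y yab).
- move=> x xab.
  have [||e e0 eQ] := @lebesgue_number1
      (fun y e => forall x', `|x' - x| < e -> Q x' y e) a b ab.
  + by move=> y e e' ee' H x' xx'; apply: Qle ee' (H x' (lt_le_trans xx' ee')).
  + by move=> y yab; have [e e0 eQ] := Qloc x y xab yab; exists e => // y' ? x' ?; apply: eQ.
  by exists e => // x' xx' y yab; apply: eQ.
by exists e => // x y xab yab; apply: eQ.
Qed.

Lemma sum_sqr_continuous x y d : 0 < d -> exists2 e, 0 < e &
  forall x' y', `|x' - x| < e -> `|y' - y| < e ->
    `|(x' ^+ 2 + y' ^+ 2) - (x ^+ 2 + y ^+ 2)| < d.
Proof.
(* The estimates for the two coordinates add up to [2 * A * e], where [e = d / (2 * A)]; this equals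
   [d]. *)
move=> d0; pose A := `|x| + `|y| + 1.
have A0 : 0 < A by rewrite /A ltr_wpDl // addr_ge0.
exists (Num.min 1 (d / (2 * A))); first by rewrite lt_min ltr01 divr_gt0 // mulr_gt0.
move=> x' y'; rewrite !lt_min => /andP[hx1 hx] /andP[hy1 hy].
set e := d / (2 * A) in hx hy.
have eA : 2 * A * e = d by rewrite /e mulrC divfK // mulf_neq0 // gt_eqF.
rewrite (_ : _ - _ = (x' ^+ 2 - x ^+ 2) + (y' ^+ 2 - y ^+ 2)); last by ring.
have := ler_normD (x' ^+ 2 - x ^+ 2) (y' ^+ 2 - y ^+ 2).
have sx2 (s s' : R) : `|s' - s| < 1 -> `|s' - s| < e -> `|s' ^+ 2 - s ^+ 2| < e * (2 * `|s| + 1).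
  move=> h1 h2; rewrite subr_sqr normrM.
  have e0 : 0 < e by apply: le_lt_trans h2.
  apply: le_lt_trans (_ : e * `|s' + s| < _); first by rewrite ler_wpM2r // ltW.
  rewrite ltr_pM2l // (_ : s' + s = (s' - s) + 2 * s); last by ring.
  by apply: le_lt_trans (ler_normD _ _) _; rewrite normrM ger0_norm //; lra.
have := sx2 _ _ hx1 hx; have := sx2 _ _ hy1 hy; rewrite -eA /A; clear; nra.
Qed.

Lemma in_basic_sub_cl b z : in_basic b z -> in_basic_cl b z.
Proof.
case: b z => [[[a b] [c d]]|r] [[x y]|] //=; last exact: ltW.
by move=> [? [? [? ?]]]; rewrite !ltW.
Qed.

Lemma in_basic_open b x y : in_basic b (Some (x, y)) ->
  exists2 e, 0 < e & forall z, ball x y e z -> in_basic b z.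
Proof.
case: b => [[[a b] [c d]]|r] /=; [move=> [h1 [h2 [h3 h4]]]|move=> h].
  exists (Num.min (Num.min (x - ratr a) (ratr b - x)) (Num.min (y - ratr c) (ratr d - y))).
    by rewrite !lt_min !subr_gt0 h1 h2 h3 h4.
  move=> [[x' y']|] //=; rewrite !lt_min !ltr_norml.
  move=> [/andP[/andP[k1 k2] _] /andP[_ /andP[k3 k4]]].
  move: (ratr a) (ratr b) (ratr c) (ratr d) h1 h2 h3 h4 k1 k2 k3 k4 => a' b' c' d'.
  by move=> *; repeat split; lra.
have [|e e0 eP] := @sum_sqr_continuous x y (x ^+ 2 + y ^+ 2 - ratr r ^+ 2).
  by rewrite subr_gt0.
exists e => // -[[x' y']|] //= [hx hy].
have := eP _ _ hx hy; rewrite ltr_norml => /andP[k _].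
move: (ratr r ^+ 2) k => s k; lra.
Qed.

Lemma in_basic_cl_closed b x y : ~ in_basic_cl b (Some (x, y)) ->
  exists2 e, 0 < e & forall z, ball x y e z -> ~ in_basic_cl b z.
Proof.
case: b => [[[a b] [c d]]|r] /=.
  move=> h; have : [|| x < ratr a, ratr b < x, y < ratr c | ratr d < y].
    apply/negPn/negP; rewrite !negb_or -!leNgt => /and4P[? ? ? ?]; exact: h.
  have [a' ->] : exists a' : R, ratr a = a' by exists (ratr a).
  have [b' ->] : exists b' : R, ratr b = b' by exists (ratr b).
  have [c' ->] : exists c' : R, ratr c = c' by exists (ratr c).
  have [d' ->] : exists d' : R, ratr d = d' by exists (ratr d).
  clear; case/or4P => h.
  - exists (a' - x); first by rewrite subr_gt0.
    by move=> [[x' y']|] //=; rewrite !ltr_norml => -[? ?] [? ?]; lra.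
  - exists (x - b'); first by rewrite subr_gt0.
    by move=> [[x' y']|] //=; rewrite !ltr_norml => -[? ?] [? [? ?]]; lra.
  - exists (c' - y); first by rewrite subr_gt0.
    by move=> [[x' y']|] //=; rewrite !ltr_norml => -[? ?] [? [? [? ?]]]; lra.
  - exists (y - d'); first by rewrite subr_gt0.
    by move=> [[x' y']|] //=; rewrite !ltr_norml => -[? ?] [? [? [? ?]]]; lra.
move/negP; rewrite -ltNge => h.
have [|e e0 eP] := @sum_sqr_continuous x y (ratr r ^+ 2 - (x ^+ 2 + y ^+ 2)).
  by rewrite subr_gt0.
exists e => // -[[x' y']|] //= [hx hy].
have := eP _ _ hx hy; rewrite ltr_norml => /andP[_ k].
move: (ratr r ^+ 2) k => s k; lra.
Qed.

Lemma ball_basic x y e : 0 < e -> exists b, [/\ basic_valid b, in_basic b (Some (x, y)) &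
  forall z, in_basic b z -> ball x y e z].
Proof.
move=> e0.
have rat_around (s : R) : exists a b : rat, [/\ a < b, ratr a < s, s < ratr b,
    s - e < ratr a & ratr b < s + e].
  have /rat_in_itvoo[a] : s - e < s by rewrite ltrBlDr ltrDl.
  rewrite in_itv /= => /andP[a1 a2].
  have /rat_in_itvoo[b] : s < s + e by rewrite ltrDl.
  rewrite in_itv /= => /andP[b1 b2]; exists a, b; split=> //.
  by rewrite -(ltr_rat R); apply: lt_trans b1.
have [a [b [ab a1 b1 a2 b2]]] := rat_around x.
have [c [d [cd c1 d1 c2 d2]]] := rat_around y.
exists (inl ((a, b), (c, d))); split=> //.
move=> [[x' y']|] //= [h1 [h2 [h3 h4]]].
have [a' Ea] : exists a' : R, ratr a = a' by exists (ratr a).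
have [b' Eb] : exists b' : R, ratr b = b' by exists (ratr b).
have [c' Ec] : exists c' : R, ratr c = c' by exists (ratr c).
have [d' Ed] : exists d' : R, ratr d = d' by exists (ratr d).
rewrite Ea in a1 a2 h1; rewrite Eb in b1 b2 h2.
rewrite Ec in c1 c2 h3; rewrite Ed in d1 d2 h4.
clear rat_around Ea Eb Ec Ed ab cd; rewrite !ltr_norml; split; lra.
Qed.

Lemma copen_ball U x y : copen U -> U (Some (x, y)) ->
  exists2 e, 0 < e & forall z, ball x y e z -> U z.
Proof.
move=> oU /oU[b [_ [bxy bU]]]; have [e e0 eb] := in_basic_open bxy.
by exists e => // z /eb/bU.
Qed.

Lemma ball_center x y e : 0 < e -> ball x y e (Some (x, y)).
Proof. by rewrite /= !subrr normr0. Qed.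

(** * Connected sets and components *)

Lemma cconnected1 z : cconnected (fun w => w = z).
Proof. by move=> [U [V [_ [_ [_ [[_ [-> Uz]] [[_ [-> Vz]] /(_ z)]]]]]]]; apply. Qed.

Section Component.
Variables (S : cset R) (p : Chat R).

Lemma ccomponent_sub z : ccomponent_of S p z -> S z.
Proof. by move=> [T [_ [TS [_ Tz]]]]; apply: TS. Qed.

Lemma ccomponent_refl : S p -> ccomponent_of S p p.
Proof. by move=> Sp; exists (fun w => w = p); split; [exact: cconnected1|split=> // w ->]. Qed.

(** If two open sets separated [u] from [v], the one that contains [p] would leave either the
    connected set joining [p] to [u] or the one joining [p] to [v] separated. *)
Lemma ccomponent_connected : cconnected (ccomponent_of S p).
Proof.
move=> [U [V [oU [oV [cov [[u [Cu Uu]] [[v [Cv Vv]] dis]]]]]]].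
have sub T : cconnected T -> (forall w, T w -> S w) -> T p ->
    forall w, T w -> ccomponent_of S p w by move=> cT TS Tp w Tw; exists T.
have [T [cT [TS [Tp Tu]]]] := Cu; have [T' [cT' [TS' [Tp' Tv]]]] := Cv.
have TC := sub _ cT TS Tp; have TC' := sub _ cT' TS' Tp'.
case: (cov p (TC p Tp)) => [Up|Vp].
  apply: cT'; exists U, V; do 2!split=> //; split; first by move=> z /TC'/cov.
  by split; [exists p|split; [exists v|move=> z [/TC' ? ?]; apply: (dis z)]].
apply: cT; exists U, V; do 2!split=> //; split; first by move=> z /TC/cov.
by split; [exists u|split; [exists p|move=> z [/TC ? ?]; apply: (dis z)]].
Qed.

(** An open set containing the limit point already meets [T], so a separation of the larger set
    restricts to one of [T]. *)
Lemma cconnected_add_limit T z : cconnected T -> cclosure T z ->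
  cconnected (fun w => T w \/ w = z).
Proof.
move=> cT clz [U [V [oU [oV [cov [[u [Tu Uu]] [[v [Tv Vv]] dis]]]]]]].
have meets W w : copen W -> T w \/ w = z -> W w -> exists w', T w' /\ W w'.
  move=> oW [Tw Ww|-> Wz]; first by exists w.
  have [b [vb [bz bW]]] := oW _ Wz; have [w' [bw' Tw']] := clz b vb bz.
  by exists w'; split=> //; apply: bW.
apply: cT; exists U, V; do 2!split=> //; split; first by move=> w Tw; apply: cov; left.
split; first exact: meets Uu; split; first exact: meets Vv.
by move=> w [Tw UVw]; apply: (dis w); split=> //; left.
Qed.

Lemma ccomponent_closed z :
  S p -> cclosure (ccomponent_of S p) z -> S z -> ccomponent_of S p z.
Proof.
move=> Sp clz Sz; exists (fun w => ccomponent_of S p w \/ w = z); split.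
  exact: cconnected_add_limit ccomponent_connected clz.
split; first by move=> w [/ccomponent_sub|->].
by split; [left; exact: ccomponent_refl|right].
Qed.

Lemma ccomponent_sym z : ccomponent_of S p z -> ccomponent_of S z p.
Proof. by move=> [T [cT [TS [Tp Tz]]]]; exists T. Qed.
End Component.

Lemma ccomponent_trans S p q z :
  ccomponent_of S p q -> ccomponent_of S q z -> ccomponent_of S p z.
Proof.
move=> Cpq Cqz; exists (ccomponent_of S q); split; first exact: ccomponent_connected.
by split; [exact: ccomponent_sub|split; [exact: ccomponent_sym|]].
Qed.
End Topology.

Lemma ball_shift (R : realType) (x y x' y' d e e' : R) z :
  `|x' - x| <= d -> `|y' - y| <= d -> e' + d <= e -> ball x' y' e' z -> ball x y e z.
Proof.
case: z => [[s t]|] //= hx hy he [hs ht].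
have := ler_distD x' s x; have := ler_distD y' t y.
by split; lra.
Qed.

Lemma ball_le (R : realType) (x y e e' : R) z : e' <= e -> ball x y e' z -> ball x y e z.
Proof. by move=> he; apply: (@ball_shift _ _ _ _ _ 0); rewrite ?subrr ?normr0 // addr0. Qed.

Lemma ord_common_eps (R : realType) n (P : 'I_n -> R -> Prop) :
  (forall l e e', e' <= e -> P l e -> P l e') ->
  (forall l, exists2 e, 0 < e & P l e) -> exists2 e, 0 < e & forall l, P l e.
Proof.
elim: n P => [|n IH] P Ple Pex; first by exists 1 => [|[]].
have [|l|e e0 eP] := IH (fun l => P (lift ord0 l)).
- by move=> l e e'; apply: Ple.
- exact: Pex.
have [e1 e10 e1P] := Pex ord0; exists (Num.min e e1); first by rewrite lt_min e0.
move=> l; case: (unliftP ord0 l) => [k ->|->].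
  by apply: Ple (eP k); rewrite ge_min lexx.
by apply: Ple e1P; rewrite ge_min lexx orbT.
Qed.

(** * The components of the complement of D *)

Section Domain.
Variables (R : realType) (D : cset R) (n : nat) (C : 'I_n -> cset R).
Hypotheses (oD : copen D) (Dinf : D None) (labC : component_labeling (ccompl D) C).
Implicit Types (x y e : R) (z : Chat R) (l : 'I_n).

Lemma labeling_component l : exists2 p, ~ D p & C l = ccomponent_of (ccompl D) p.
Proof.
have [/(_ l)[p [Kp Cp]] _] := labC; exists p => //.
by apply/funext => z; apply/propext.
Qed.

Lemma labeling_cover z : ~ D z -> exists l, C l z.
Proof.
move=> Kz; have [_ [_ /(_ (ccomponent_of (ccompl D) z))]] := labC.
case; first by exists z.
by move=> l /(_ z)[h _]; exists l; apply/h/ccomponent_refl.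
Qed.

Lemma labeling_sub l z : C l z -> ~ D z.
Proof. by have [p _ ->] := labeling_component l; apply: ccomponent_sub. Qed.

Lemma labeling_inj l l' z : C l z -> C l' z -> l = l'.
Proof.
have [_ [inj _]] := labC => Cz Cz'; apply: inj => w.
move: Cz Cz'; have [p _ ->] := labeling_component l.
have [q _ ->] := labeling_component l' => pz qz; split=> h.
  exact: ccomponent_trans (ccomponent_trans qz (ccomponent_sym pz)) h.
exact: ccomponent_trans (ccomponent_trans pz (ccomponent_sym qz)) h.
Qed.

Lemma labeling_nonempty l : exists z, C l z.
Proof.
by have [p Kp ->] := labeling_component l; exists p; apply: ccomponent_refl.
Qed.

Lemma labeling_connected l : cconnected (C l).
Proof. by have [p _ ->] := labeling_component l; apply: ccomponent_connected. Qed.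

(** As D is open, the limit point stays in the complement, where components are relatively
    closed. *)
Lemma labeling_closed l z : cclosure (C l) z -> C l z.
Proof.
move=> clz; have Kz : ~ D z.
  by move=> /oD[b [vb [bz bD]]]; have [w [/bD Dw /labeling_sub]] := clz b vb bz.
by move: clz; have [p Kp ->] := labeling_component l => clz; apply: ccomponent_closed.
Qed.

Lemma compl_finite z : ~ D z -> exists x y, z = Some (x, y).
Proof. by case: z => [[x y]|] // _; exists x, y. Qed.

(** Each of the finitely many components is closed, so a small ball about a point of one component
    avoids all the others. *)
Lemma labeling_isolated x y : exists2 e, 0 < e &
  forall l l' w w', ball x y e w -> ball x y e w' -> C l w -> C l' w' -> l = l'.
Proof.
have [Dxy|Kxy] := pselect (D (Some (x, y))).
  have [e e0 eD] := copen_ball oD Dxy; exists e => // l l' w w' /eD Dw _ /labeling_sub.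
  by move/(_ Dw).
have [l0 Cxy] := labeling_cover Kxy.
have [||e e0 eP] := @ord_common_eps R n
    (fun l e => l <> l0 -> forall w, ball x y e w -> ~ C l w).
- by move=> l e e' ee' h ll0 w /(ball_le ee'); apply: h.
- move=> l; have [->|ll0] := eqVneq l l0; first by exists 1.
  have [//|h] := pselect (exists2 e, 0 < e & l <> l0 -> forall w, ball x y e w -> ~ C l w).
  exfalso; move/eqP: ll0; apply; apply: (@labeling_inj _ _ (Some (x, y))) => //.
  apply: labeling_closed => b vb bxy; have [e e0 eb] := in_basic_open bxy.
  apply: contrapT => nw; apply: h; exists e => // _ w bw Cw.
  by apply: nw; exists w; split=> //; apply: eb.
exists e => // l l' w w' bw bw' Cw Cw'.
have eq0 k u : ball x y e u -> C k u -> k = l0.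
  by move=> bu Cu; apply: contrapT => kl0; apply: eP kl0 u bu Cu.
by rewrite (eq0 l w) // (eq0 l' w').
Qed.

Lemma labeling_nbhs l x y : C l (Some (x, y)) ->
  exists2 e, 0 < e & forall w, ball x y e w -> ~ D w -> C l w.
Proof.
move=> Cxy; have [e e0 eP] := labeling_isolated x y; exists e => // w bw.
move=> /labeling_cover[l' Cw].
by rewrite (eP l l' (Some (x, y)) w) //; apply: ball_center.
Qed.

(** The radius is raised to a larger integer because a name of D lists only sets whose closure lies
    in D. *)
Lemma compl_bounded : exists B : nat, forall z, in_basic_cl (inr B.+1%:R) z -> D z.
Proof.
have [b [vb [bN bD]]] := oD Dinf.
case: b vb bN bD => [[[? ?] [? ?]]|r] //= r0 _ rD.
have [B rB] : exists B : nat, (r < B.+1%:R)%R.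
  have := archi_boundP (ltW r0); set B := Num.bound _ => rB.
  by exists B; apply: lt_trans rB _; rewrite ltr_nat.
exists B => z h; apply: rD; case: z h => [[x y]|] //=.
apply: lt_le_trans; rewrite ltr_sqr ?nnegrE ?ler0q ?ltr_rat // ?ler0n //.
exact: ltW.
Qed.

Lemma compl_box (B : nat) x y : (forall z, in_basic_cl (inr B%:R) z -> D z) ->
  ~ D (Some (x, y)) -> `|x| <= B%:R /\ `|y| <= B%:R.
Proof.
move=> BD Kxy; have : x ^+ 2 + y ^+ 2 < B%:R ^+ 2.
  by rewrite ltNge; apply/negP => h; apply/Kxy/BD => /=; rewrite ratr_nat.
rewrite -[x ^+ 2]real_normK ?num_real // -[y ^+ 2]real_normK ?num_real // => h.
have B0 : 0 <= B%:R :> R by [].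
have := normr_ge0 x; have := normr_ge0 y.
move: `|x| `|y| (B%:R : R) B0 h => s t b b0 h t0 s0.
by split; rewrite leNgt; apply/negP => ?; nra.
Qed.

(** Start in the component and move right as long as the segment stays in it; this is bounded. The
    last point belongs to the component by closedness. If it were not a limit of D, a neighbourhood
    would avoid D, hence lie in the component by [labeling_nbhs], and the segment could be
    prolonged. *)
Lemma labeling_boundary l : exists x y, C l (Some (x, y)) /\ cclosure D (Some (x, y)).
Proof.
have [z Cz] := labeling_nonempty l.
have [x0 [y0 zE]] := compl_finite (labeling_sub Cz); rewrite {}zE in Cz.
have [B BD] := compl_bounded.
pose E := (fun t => 0 <= t /\ forall s, 0 <= s <= t -> C l (Some (x0 + s, y0))) : R -> Prop.
have E0 : E 0 by split=> // s; rewrite -eq_le => /eqP <-; rewrite addr0.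
have ubE t : E t -> t <= B.+1%:R - x0.
  move=> [t0 Et]; have /labeling_sub/(compl_box BD)[h _] : C l (Some (x0 + t, y0)).
    by apply: Et; rewrite t0 lexx.
  by move: h; rewrite ler_norml => /andP[_]; rewrite lerBrDl.
have supE : has_sup E by split; [exists 0|exists (B.+1%:R - x0) => t /ubE].
have sE t : E t -> t <= sup E by move=> Et; apply: (sup_upper_bound supE).
have s0 : 0 <= sup E by apply: sE.
have below t : 0 <= t < sup E -> C l (Some (x0 + t, y0)).
  move=> /andP[t0 ts]; have [|u [_ Eu] tu] := @sup_adherent _ E (sup E - t) _ supE.
    by rewrite subr_gt0.
  by apply: Eu; rewrite t0 /= ltW // (le_lt_trans _ tu) // opprB addrC subrK.
have Cs : C l (Some (x0 + sup E, y0)).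
  have [<-|s_neq0] := eqVneq 0 (sup E); first by rewrite addr0.
  have s_gt0 : 0 < sup E by rewrite lt0r eq_sym s_neq0.
  apply: labeling_closed => b vb /in_basic_open[e e0 eb].
  pose t := Num.max 0 (sup E - e / 2).
  have ts : 0 <= t < sup E by rewrite /t le_max lexx gt_max s_gt0 /=; lra.
  exists (Some (x0 + t, y0)); split; last exact: below.
  apply: eb => /=; rewrite subrr normr0; split=> //.
  have : sup E - e / 2 <= t by rewrite /t le_max lexx orbT.
  by move: ts => /andP[_ ts]; rewrite ltr_norml; lra.
exists (x0 + sup E), y0; split=> // b vb /in_basic_open[e e0 eb].
apply: contrapT => nD; have [e1 e10 e1C] := labeling_nbhs Cs.
have ball_in s : sup E <= s <= sup E + Num.min e e1 / 2 -> C l (Some (x0 + s, y0)).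
  move=> /andP[h1 h2]; have e2 : 0 < Num.min e e1 by rewrite lt_min e0.
  have bs : ball (x0 + sup E) y0 (Num.min e e1) (Some (x0 + s, y0)).
    by rewrite /= subrr normr0; split=> //; rewrite ltr_norml; lra.
  apply: e1C; first by apply: ball_le bs; rewrite ge_min lexx orbT.
  move=> Dw; apply: nD; exists (Some (x0 + s, y0)); split=> //; apply: eb.
  by apply: ball_le bs; rewrite ge_min lexx.
have e2 : 0 < Num.min e e1 by rewrite lt_min e0.
have : E (sup E + Num.min e e1 / 2).
  split=> [|s /andP[s1 s2]]; first by lra.
  by have [h|h] := ltP s (sup E); [apply: below; rewrite s1|apply: ball_in; rewrite h].
by move/sE; lra.
Qed.

(** A Lebesgue number, over a box containing the complement, for the balls of [labeling_isolated].
    They are halved so that their centre may move. *)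
Lemma labeling_distance : exists2 e, 0 < e & forall l l' x y x' y',
  C l (Some (x, y)) -> C l' (Some (x', y')) -> `|x - x'| < e -> `|y - y'| < e -> l = l'.
Proof.
have [B BD] := compl_bounded.
have B0 : - B.+1%:R <= B.+1%:R :> R by rewrite ge0_cp.
have [||e e0 eQ] := @lebesgue_number2 R (fun x y e => forall l l' w w',
  ball x y e w -> ball x y e w' -> C l w -> C l' w' -> l = l') _ _ B0.
- by move=> x y e e' ee' h l l' w w' bw bw'; apply: h; apply: ball_le ee' _.
- move=> x y _ _; have [e e0 eP] := labeling_isolated x y.
  exists (e / 2); first by rewrite divr_gt0.
  move=> x' y' hx hy l l' w w' bw bw'.
  have e2 : e / 2 + e / 2 <= e by rewrite -splitr.
  by apply: eP; [exact: ball_shift (ltW hx) (ltW hy) e2 bw|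
                 exact: ball_shift (ltW hx) (ltW hy) e2 bw'].
exists e => // l l' x y x' y' Cz Cz' hx hy.
have [xB yB] := compl_box BD (labeling_sub Cz).
apply: (eQ x y _ _ l l' (Some (x, y)) (Some (x', y'))) => //; rewrite -?ler_norml //.
  exact: ball_center.
by rewrite /= distrC; split=> //; rewrite distrC.
Qed.

End Domain.

(** * Correctness *)

Lemma listed_sound P p s f : lists_exactly P p -> bok f -> listed p s f -> P (bdec f).
Proof.
move=> [Pp _] okf /hasP[k _ /eqP pk].
case: (Pp k) => [|[b [Pb]]]; rewrite pk // => -[].
by rewrite -pickle_bdec // => /(pcan_inj pickleK) ->.
Qed.

Lemma listed_mono p s s' f : (s <= s')%N -> listed p s f -> listed p s' f.
Proof.
move=> ss' /hasP[k]; rewrite mem_iota => /andP[_ ks] pk; apply/hasP; exists k => //.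
by rewrite mem_iota /= (leq_trans ks).
Qed.

(** The stage exceeds both the code [f] and its position in the name, since [in_listed] and
    [has_listed] bound both searches by the same stage. *)
Lemma listed_complete P p b : lists_exactly P p -> basic_valid b -> P b ->
  exists f s, [/\ bok f, bdec f = b & forall s', (s <= s')%N ->
    (f < s')%N /\ listed p s' f].
Proof.
move=> [_ pP] /bdec_surj[f okf fb] /pP[k pk]; exists f, (maxn f.+1 k.+1).
split=> // s'; rewrite geq_max => /andP[fs ks]; split=> //.
by apply/hasP; exists k; rewrite ?mem_iota // pk -fb pickle_bdec.
Qed.

Lemma common_stage (P : nat -> nat -> Prop) W :
  (forall i s s', (s <= s')%N -> P i s -> P i s') ->
  (forall i, (i < W)%N -> exists s, P i s) -> exists s, forall i, (i < W)%N -> P i s.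
Proof.
move=> Ple; elim: W => [|W IH] Pex; first by exists 0%N.
have [|s sP] := IH; first by move=> i iW; apply: Pex; rewrite ltnS ltnW.
have [s1 s1P] := Pex W (ltnSn W); exists (maxn s s1) => i.
rewrite ltnS leq_eqVlt => /orP[/eqP ->|iW].
  by apply: Ple s1P; rewrite leq_maxr.
by apply: Ple (sP i iW); rewrite leq_maxl.
Qed.

Lemma in_listed_mono p s s' i j v M :
  (s <= s')%N -> in_listed p s i j v M -> in_listed p s' i j v M.
Proof.
move=> ss' /hasP[f]; rewrite mem_iota => /andP[_ fs] /and3P[okf lf tf].
apply/hasP; exists f; first by rewrite mem_iota /= (leq_trans fs).
by rewrite okf tf (listed_mono ss').
Qed.

Lemma has_listed_mono p s s' i j v M :
  (s <= s')%N -> has_listed p s i j v M -> has_listed p s' i j v M.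
Proof.
move=> ss' /hasP[f]; rewrite mem_iota => /andP[_ fs] /and3P[okf lf tf].
apply/hasP; exists f; first by rewrite mem_iota /= (leq_trans fs).
by rewrite okf tf (listed_mono ss').
Qed.

Lemma allP_iota (P : pred nat) m : reflect (forall i, (i < m)%N -> P i) (all P (iota 0 m)).
Proof.
apply: (iffP allP) => [h i im|h i]; first by apply: h; rewrite mem_iota.
by rewrite mem_iota => /andP[_]; apply: h.
Qed.

Lemma hasP_iota (P : pred nat) m : reflect (exists2 i, (i < m)%N & P i) (has P (iota 0 m)).
Proof.
apply: (iffP hasP) => [[i]|[i im Pi]]; first by rewrite mem_iota => /andP[_]; exists i.
by exists i; rewrite ?mem_iota.
Qed.

Lemma digits_surj b (d : nat -> nat) m : (forall i, d i <= b)%N ->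
  exists w, forall i, (i < m)%N -> (w %/ b.+1 ^ i %% b.+1 = d i)%N.
Proof.
elim: m d => [|m IH] d db; first by exists 0%N.
have [|w wP] := IH (fun i => d i.+1); first by move=> i; apply: db.
exists (w * b.+1 + d 0)%N => -[|i] im.
  by rewrite expn0 divn1 modnMDl modn_small // ltnS db.
rewrite expnS divnMA divnMDl // (@divn_small (d 0%N)) ?ltnS ?db // addn0; exact: wP.
Qed.

(** * The grid and its refinements *)

Lemma square_valid i j v M : (0 < M)%N -> basic_valid (square i j v M).
Proof.
move=> M0; have M0' : 0 < M%:R :> rat by rewrite ltr0n.
by rewrite /= /gridq !ltr_pM2r ?invr_gt0 // -!natr1; lra.
Qed.

Section Squares.
Variable R : realType.
Implicit Types (x y e : R) (z : Chat R).

Lemma square_neighbour i j i' j' v M z : (0 < M)%N ->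
  in_basic (square i j v M) z -> in_basic (square i' j' v M) z ->
  [/\ (i <= i'.+1)%N, (i' <= i.+1)%N, (j <= j'.+1)%N & (j' <= j.+1)%N].
Proof.
case: z => [[x y]|] // M0 /(square_Some _ _ _ _ _ M0)[hx hy].
move=> /(square_Some _ _ _ _ _ M0)[hx' hy'].
have aux (a b : nat) (s : R) :
    `|s - (a%:R - v%:R)| < 1 -> `|s - (b%:R - v%:R)| < 1 -> (a <= b.+1)%N.
  rewrite !ltr_norml => h1 h2; rewrite -ltnS -(ltr_nat R) -!natr1; lra.
by split; apply: aux; eauto.
Qed.

(** Write [a = q * G + r] with [r + 1 <= G], where [G] is [g.+1]: the interval from [a - 1] to
    [a + 1] lies between [(q - 1) * G] and [(q + 1) * G]. *)
Lemma square_refine i j v M g z : (0 < M)%N ->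
  in_basic (square i j (v * g.+1) (M * g.+1)) z ->
  in_basic (square (i %/ g.+1) (j %/ g.+1) v M) z.
Proof.
case: z => [[x y]|] // M0; have Mg0 : (0 < M * g.+1)%N by rewrite muln_gt0 M0.
move=> /(square_Some _ _ _ _ _ Mg0)[hx hy]; apply/square_Some => //.
have aux (a : nat) (s : R) : `|s * (M * g.+1)%:R - (a%:R - (v * g.+1)%:R)| < 1 ->
    `|s * M%:R - ((a %/ g.+1)%N%:R - v%:R)| < 1.
  have := ltn_pmod a (ltn0Sn g); rewrite {2}(divn_eq a g.+1).
  move: (a %/ g.+1)%N (a %% g.+1)%N => q r rg.
  have g1 : 0 < g.+1%:R :> R by rewrite ltr0n.
  have rg' : r%:R + 1 <= g.+1%:R :> R by rewrite natr1 ler_nat.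
  have r0 : 0 <= r%:R :> R by [].
  rewrite natrD !natrM => h; rewrite -(ltr_pM2r g1) mul1r -[X in `|_| * X](gtr0_norm g1) -normrM.
  move: (g.+1%:R : R) (r%:R : R) (M%:R : R) (v%:R : R) (q%:R : R) g1 rg' r0 h.
  move=> G r' M' v' q' G0 rG r0; rewrite !ltr_norml => h.
  have -> : (s * M' - (q' - v')) * G = s * (M' * G) - (q' * G + r' - v' * G) + r' by ring.
  lra.
by split; apply: aux.
Qed.

Lemma square_cover (B M : nat) x : (0 < M)%N -> `|x| <= B%:R ->
  exists2 i, (i < 2 * (B * M) + 1)%N & `|x * M%:R - (i%:R - (B * M)%:R)| < 1.
Proof.
move=> M0; rewrite ler_norml => /andP[x1 x2].
have M0' : 0 < M%:R :> R by rewrite ltr0n.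
have h0 : 0 <= x * M%:R + (B * M)%:R.
  by rewrite natrM -mulrDl mulr_ge0 //; lra.
(* The index is the integer part of the coordinate, shifted to be nonnegative. The value
   [2 * (B * M)] occurs at the right edge of the box, whence the [+ 1] in the width. *)
have := truncn_itv h0; set i := Num.truncn _ => /andP[i1 i2].
exists i; last by rewrite -natr1 in i2; rewrite ltr_norml; lra.
rewrite addn1 ltnS -(ler_nat R); apply: le_trans i1 _.
by rewrite mul2n -addnn !natrD !natrM lerD2r ler_pM2r.
Qed.

Lemma grid_center i v M : (0 < M)%N -> gridq R i v M * M%:R = i%:R - v%:R.
Proof. by move=> M0; rewrite /gridq divfK // pnatr_eq0 -lt0n. Qed.

Lemma square_center i j v M : (0 < M)%N ->
  in_basic (square i j v M) (Some (gridq R i v M, gridq R j v M)).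
Proof.
by move=> M0; apply/square_Some; rewrite // !grid_center // !subrr normr0.
Qed.

Lemma square_cl_ball i j v M z : (0 < M)%N -> in_basic_cl (square i j v M) z ->
  ball (gridq R i v M) (gridq R j v M) (2 / M%:R) z.
Proof.
case: z => [[x y]|] // M0 /=; rewrite !ratr_gridq.
have M1 : 0 < M%:R^-1 :> R by rewrite invr_gt0 ltr0n.
rewrite !gridqSr !gridqSl; move: (gridq R i v M) (gridq R j v M) => a b [? [? [? ?]]].
by rewrite !ltr_norml; split; lra.
Qed.

Lemma square_ball i j v M x y : (0 < M)%N -> in_basic (square i j v M) (Some (x, y)) ->
  `|gridq R i v M - x| <= M%:R^-1 /\ `|gridq R j v M - y| <= M%:R^-1.
Proof.
move=> M0 /(square_Some _ _ _ _ _ M0)[].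
have M1 : 0 < M%:R^-1 :> R by rewrite invr_gt0 ltr0n.
have MV : M%:R * M%:R^-1 = 1 :> R by rewrite divff // pnatr_eq0 -lt0n.
have aux (s : R) (a : nat) : `|s * M%:R - (a%:R - v%:R)| < 1 -> `|gridq R a v M - s| <= M%:R^-1.
  move=> h; rewrite distrC -[X in _ <= X]mul1r -(grid_center a v M0) in h *.
  rewrite -mulrBl normrM (gtr0_norm (_ : 0 < M%:R)) ?ltr0n // in h.
  by rewrite ltW // -ltr_pdivrMr // invrK.
by move=> hx hy; split; apply: aux.
Qed.
End Squares.

Section Separation.
Variables (R : realType) (D : cset R) (n : nat) (pD pB : nat -> nat).
Hypotheses (oD : copen D) (pDP : open_name D pD) (pBP : closed_name (cboundary D) pB).
Implicit Types (x y e : R) (z : Chat R).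

Lemma in_listed_sound s i j v M z : (0 < M)%N -> in_listed pD s i j v M ->
  in_basic (square i j v M) z -> D z.
Proof.
move=> M0 /hasP_iota[f _ /and3P[okf lf tf]] /(bin_sound M0 okf tf) zf.
by have [_ fD] := listed_sound pDP okf lf; apply/fD/in_basic_sub_cl.
Qed.

(** Grid squares have rational vertices, so the square is itself a basic set and its own code
    appears in the name. *)
Lemma in_listed_complete i j v M : (0 < M)%N ->
  (forall z, in_basic_cl (square i j v M) z -> D z) -> exists s, in_listed pD s i j v M.
Proof.
move=> M0 sqD; have vsq := square_valid i j v M0.
have [f [s [okf fE fs]]] := listed_complete pDP vsq (conj vsq sqD).
have [lf1 lf2] := fs s (leqnn s); exists s; apply/hasP_iota; exists f => //.
by rewrite okf lf2 (bin_square R).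
Qed.

Lemma has_listed_sound s i j v M : (0 < M)%N -> has_listed pB s i j v M ->
  exists z, in_basic (square i j v M) z /\ cboundary D z.
Proof.
move=> M0 /hasP_iota[f _ /and3P[okf lf tf]].
have [_ [z [fz Bz]]] := listed_sound pBP okf lf.
by exists z; split=> //; apply: (bsub_sound M0 tf).
Qed.

Lemma has_listed_complete i j v M z : (0 < M)%N ->
  in_basic (square i j v M) z -> cboundary D z -> exists s, has_listed pB s i j v M.
Proof.
move=> M0 sqz Bz; have vsq := square_valid i j v M0.
have [f [s [okf fE fs]]] := listed_complete pBP vsq (conj vsq (ex_intro _ z (conj sqz Bz))).
have [lf1 lf2] := fs s (leqnn s); exists s; apply/hasP_iota; exists f => //.
by rewrite okf lf2 (bsub_square R).
Qed.

Lemma cboundary_open z : cboundary D z <-> cclosure D z /\ ~ D z.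
Proof.
split=> -[clz Dz]; split=> // h; apply: Dz; first by have [b ?] := oD h; exists b.
by have [b [_ [bz bD]]] := h; apply: bD.
Qed.
End Separation.

(** * Existence of a separation *)

Section Existence.
Variables (R : realType) (D : cset R) (n : nat) (C : 'I_n -> cset R) (pD pB : nat -> nat).
Hypotheses (oD : copen D) (Dinf : D None) (labC : component_labeling (ccompl D) C).
Hypotheses (pDP : open_name D pD) (pBP : closed_name (cboundary D) pB).

(** At most [1 / N] from each point to its centre, and [1 / N] between centres of neighbouring
    squares. *)
Lemma grid_close (N : nat) (i i' v : nat) (x x' : R) : (0 < N)%N ->
  (i <= i'.+1)%N -> (i' <= i.+1)%N ->
  `|x - gridq R i v N| <= N%:R^-1 -> `|x' - gridq R i' v N| <= N%:R^-1 ->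
  `|x - x'| <= 3 / N%:R.
Proof.
move=> N0 h1 h2.
have N1 : 0 < N%:R^-1 :> R by rewrite invr_gt0 ltr0n.
have : `|gridq R i v N - gridq R i' v N| <= N%:R^-1.
  rewrite /gridq -mulrBl normrM (gtr0_norm N1); apply: ler_piMl; first exact: ltW.
  rewrite -(ler_nat R) -natr1 in h1; rewrite -(ler_nat R) -natr1 in h2.
  by rewrite ler_norml; lra.
move: (gridq R i v N) (gridq R i' v N) => a b; rewrite !ler_norml; lra.
Qed.

Lemma square_cl_grid i j v M (x y : R) : (0 < M)%N ->
  in_basic_cl (square i j v M) (Some (x, y)) ->
  `|x - gridq R i v M| <= M%:R^-1 /\ `|y - gridq R j v M| <= M%:R^-1.
Proof.
move=> M0 /=; rewrite !ratr_gridq !gridqSr !gridqSl.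
by move: (gridq R i v M) (gridq R j v M) => a b [? [? [? ?]]]; rewrite !ler_norml; split; lra.
Qed.

Lemma separation_exists : exists t, separation pD pB n t.
Proof.
have [B BD] := compl_bounded oD Dinf.
have [e e0 eP] := labeling_distance oD Dinf labC.
(* By [grid_close], points of two neighbouring closed squares are then closer than [e] in both
   coordinates; if both are in the complement of D, they share a component. *)
have [N Ne] : exists N : nat, 3 / N.+1%:R < e.
  have := archi_boundP (ltW (divr_gt0 (ltr0n R 3) e0)); set N := Num.bound _ => h.
  exists N; rewrite ltr_pdivrMr ?ltr0n // mulrC -ltr_pdivrMr //.
  by apply: lt_trans h _; rewrite ltr_nat.
pose v := (B.+1 * N.+1)%N; pose W := (2 * v + 1)%N.
have N0 : (0 < N.+1)%N by [].
(* A square gets label 0 when its closure lies in D, for only then is it sure to be listed;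
   otherwise it gets the label of some component that meets its closure. *)
pose good i j k := (k <= n)%N /\
  ((k = 0%N /\ forall z, in_basic_cl (square i j v N.+1) z -> D z) \/
   (exists l : 'I_n, k = l.+1 /\ exists2 z, in_basic_cl (square i j v N.+1) z & C l z)).
have [lb lbP] : exists lb : nat -> nat -> nat, forall i j, good i j (lb i j).
  have ex i j : exists k, good i j k.
    have [h|h] := pselect (forall z, in_basic_cl (square i j v N.+1) z -> D z).
      by exists 0%N; split=> //; left.
    have [z [sz Kz]] : exists z, in_basic_cl (square i j v N.+1) z /\ ~ D z.
      apply: contrapT => nz; apply: h => z sz; apply: contrapT => Kz.
      by apply: nz; exists z.
    have [l Cl] := labeling_cover labC Kz; exists l.+1; split; first exact: ltn_ord.
    by right; exists l; split=> //; exists z.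
  have [lb lbP] := choice (fun ij => ex ij.1 ij.2).
  by exists (fun i j => lb (i, j)) => i j; apply: (lbP (i, j)).
have [w wP] := @digits_surj n (fun m => lb (m %/ W) (m %% W))%N (W * W)
  (fun m => proj1 (lbP _ _)).
have W0 : (0 < W)%N by rewrite /W addn1.
have {}wP i j : (i < W)%N -> (j < W)%N ->
    (w %/ n.+1 ^ (i * W + j) %% n.+1 = lb i j)%N.
  move=> iW jW; rewrite wP; last by nia.
  by rewrite divnMDl // divn_small // addn0 modnMDl modn_small.
have same i j i' j' (l l' : 'I_n) : lb i j = l.+1 -> lb i' j' = l'.+1 ->
    (i <= i'.+1)%N -> (i' <= i.+1)%N -> (j <= j'.+1)%N -> (j' <= j.+1)%N -> l = l'.
  have pt a b (k : 'I_n) : lb a b = k.+1 -> exists x y,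
      in_basic_cl (square a b v N.+1) (Some (x, y)) /\ C k (Some (x, y)).
    move=> lbk; have [_ [[]|[k' []]]] := lbP a b; rewrite lbk // => -[/ord_inj <-] [z sz Cz].
    have [x [y zE]] := compl_finite Dinf (labeling_sub labC Cz).
    by exists x, y; rewrite -zE.
  move=> /pt[x [y [sq Cxy]]] /pt[x' [y' [sq' Cxy']]] h1 h2 h3 h4.
  have [a1 a2] := square_cl_grid N0 sq; have [b1 b2] := square_cl_grid N0 sq'.
  apply: eP Cxy Cxy' _ _; apply: le_lt_trans Ne.
    exact: grid_close h1 h2 a1 b1.
  exact: grid_close h3 h4 a2 b2.
have vext : basic_valid (inr B.+1%:R) by rewrite /= ltr0n.
have [f [s1 [okf fE fs]]] := listed_complete pDP vext (conj vext BD).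
have [s2 s2P] : exists s, forall i, (i < W)%N -> forall j, (j < W)%N ->
    (lb i j != 0) || in_listed pD s i j v N.+1.
  apply: (@common_stage (fun i s => forall j, (j < W)%N -> _)).
    move=> i s s' ss' h j jW; have /orP[->//|h'] := h j jW.
    by rewrite (in_listed_mono ss') ?orbT.
  move=> i iW; apply: (@common_stage (fun j s => (lb i j != 0) || in_listed pD s i j v N.+1)).
    by move=> j s s' ss' /orP[->//|h']; rewrite (in_listed_mono ss') ?orbT.
  move=> j jW; case: (eqVneq (lb i j) 0%N) => [lb0|_]; last by exists 0%N.
  have [_ [[_ /(in_listed_complete pDP N0)[s sP]]|[l [h]]]] := lbP i j; last by rewrite lb0 in h.
  by exists s; rewrite sP.
(* A square around a boundary point in component [l] cannot be labelled 0. Its label comes from a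
   component with a point closer than [e], which is [l] itself. *)
have [s3 s3P] : exists s, forall l, (l < n)%N -> exists i j, [/\ (i < W)%N, (j < W)%N,
    lb i j = l.+1 & has_listed pB s i j v N.+1].
  apply: common_stage => [l s s' ss' [i [j [iW jW lbl h]]]|l ln].
    by exists i, j; split=> //; apply: has_listed_mono h.
  have [x [y [Cxy clxy]]] := labeling_boundary oD Dinf labC (Ordinal ln).
  have [xB yB] := compl_box BD (labeling_sub labC Cxy).
  have [i iW hx] := square_cover N0 xB; have [j jW hy] := square_cover N0 yB.
  have sq : in_basic (square i j v N.+1) (Some (x, y)) by apply/square_Some.
  have Bxy : cboundary D (Some (x, y)).
    by apply/(cboundary_open oD); split=> //; exact: (labeling_sub labC Cxy).
  have [s sP] := has_listed_complete pBP N0 sq Bxy.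
  exists s, i, j; split=> //.
  have [_ [[_ h]|[l' [lbl [z sz Cz]]]]] := lbP i j.
    by case: (labeling_sub labC Cxy); apply: h; apply: in_basic_sub_cl.
  rewrite lbl; congr S; have [x' [y' zE]] := compl_finite Dinf (labeling_sub labC Cz).
  rewrite {}zE in sz Cz; have [a1 a2] := square_cl_grid N0 (in_basic_sub_cl sq).
  have [b1 b2] := square_cl_grid N0 sz.
  rewrite -(eP (Ordinal ln) l' x y x' y') //; apply: le_lt_trans Ne.
    exact: grid_close a1 b1.
  exact: grid_close a2 b2.
pose s := maxn s1 (maxn s2 s3).
exists (cpair B.+1 (cpair N (cpair w s))); set t := cpair _ _.
have tB : box t = B.+1 by rewrite /box cpairK1.
have tN : mesh t = N.+1 by rewrite /mesh cpairK2 cpairK1.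
have ts : stage t = s by rewrite /stage !cpairK2.
have tw : labels t = w by rewrite /labels !cpairK2 cpairK1.
have tv : origin t = v by rewrite /origin tB tN.
have tW : width t = W by rewrite /width tv.
have tlab i j : (i < W)%N -> (j < W)%N -> lab n t i j = lb i j.
  by move=> iW jW; rewrite /lab tw tW wP.
rewrite /separation ts tW tv tN tB; apply/and5P; split.
- by do 2!(apply: leq_trans (leq_cpairr _ _); rewrite // ); apply: leq_cpairr.
- have [fs1 fs2] := fs s (leq_maxl _ _).
  apply/hasP_iota; exists f => //; rewrite okf fs2 /=.
  move: fE; rewrite /bdec; case: ifP => //= _ [fE].
  by rewrite (rleE R) // fE ratr_nat /gridq subr0 divr1.
- apply/allP_iota => i iW; apply/allP_iota => j jW; rewrite tlab //.
  have /orP[->//|h] := s2P i iW j jW; rewrite (in_listed_mono _ h) ?orbT //.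
  by rewrite /s leq_max leq_maxl orbT.
- apply/allP_iota => i iW; apply/allP_iota => j jW.
  apply/allP_iota => i' iW'; apply/allP_iota => j' jW'; rewrite !tlab //.
  have [_ [[-> _]//|[l [El _]]]] := lbP i j.
  have [_ [[-> _]|[l' [El' _]]]] := lbP i' j'; first by rewrite orbT.
  case: (ltnP i.+1 i') => [|h1]; first by rewrite !orbT.
  case: (ltnP i'.+1 i) => [|h2]; first by rewrite !orbT.
  case: (ltnP j.+1 j') => [|h3]; first by rewrite !orbT.
  case: (ltnP j'.+1 j) => [|h4]; first by rewrite !orbT.
  by rewrite El El' (same _ _ _ _ _ _ El El' h2 h1 h4 h3) eqxx !orbT.
- apply/allP_iota => l ln; have [i [j [iW jW lbl h]]] := s3P l ln.
  apply/hasP_iota; exists i => //; apply/hasP_iota; exists j => //.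
  rewrite tlab // lbl eqxx (has_listed_mono _ h) //.
  by rewrite /s !leq_max leqnn !orbT.
Qed.
End Existence.

(** * From a separation to the names *)

Section Soundness.
Variables (R : realType) (D : cset R) (n : nat) (C : 'I_n -> cset R).
Variables (pD pB : nat -> nat) (t : nat).
Hypotheses (oD : copen D) (Dinf : D None) (labC : component_labeling (ccompl D) C).
Hypotheses (pDP : open_name D pD) (pBP : closed_name (cboundary D) pB).
Hypothesis sep : separation pD pB n t.
Implicit Types (x y e : R) (z : Chat R) (l : nat).

Let mesh_gt0 : (0 < mesh t)%N. Proof. by []. Qed.

Let fine_gt0 g : (0 < mesh t * g.+1)%N. Proof. by rewrite muln_gt0. Qed.

Definition region l : cset R := fun z => exists i j,
  [/\ (i < width t)%N, (j < width t)%N, lab n t i j = l.+1 &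
      in_basic (square i j (origin t) (mesh t)) z].

Lemma region_open l : copen (region l).
Proof.
move=> z [i [j [iW jW labl sqz]]]; exists (square i j (origin t) (mesh t)).
split; first exact: square_valid.
by split=> // w sqw; exists i, j.
Qed.

Lemma lab_eq i j i' j' z : (i < width t)%N -> (j < width t)%N ->
  (i' < width t)%N -> (j' < width t)%N -> lab n t i j != 0%N -> lab n t i' j' != 0%N ->
  in_basic (square i j (origin t) (mesh t)) z ->
  in_basic (square i' j' (origin t) (mesh t)) z -> lab n t i j = lab n t i' j'.
Proof.
move=> iW jW iW' jW' l0 l0' sq sq'.
have [h1 h2 h3 h4] := square_neighbour mesh_gt0 sq sq'.
move: sep => /and5P[_ _ _ /allP_iota/(_ i iW)/allP_iota/(_ j jW) adj _].
move/allP_iota: adj => /(_ i' iW')/allP_iota/(_ j' jW').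
by rewrite (negbTE l0) (negbTE l0') !ltnNge h1 h2 h3 h4 /= => /eqP.
Qed.

Lemma region_disjoint l l' z : region l z -> region l' z -> l = l'.
Proof.
move=> [i [j [iW jW labl sq]]] [i' [j' [iW' jW' labl' sq']]].
have := lab_eq iW jW iW' jW'; rewrite labl labl' => /(_ z isT isT sq sq').
by case.
Qed.

Lemma lab_neq0 i j z : (i < width t)%N -> (j < width t)%N ->
  in_basic (square i j (origin t) (mesh t)) z -> ~ D z -> lab n t i j != 0%N.
Proof.
move=> iW jW sqz Kz; move: sep => /and5P[_ _ /allP_iota/(_ i iW)/allP_iota/(_ j jW) h _ _].
by case/orP: h => // /(in_listed_sound pDP mesh_gt0)/(_ sqz).
Qed.

Lemma separation_box x y : ~ D (Some (x, y)) -> `|x| <= (box t)%:R /\ `|y| <= (box t)%:R.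
Proof.
apply: compl_box => -[[u w]|] // h.
move: sep => /and5P[_ /hasP_iota[f _ /and4P[okf lf ef rf]] _ _ _].
have [vf fD] := listed_sound pDP okf lf; apply: fD.
move: vf rf h; rewrite (rleE R) // /gridq subr0 divr1 /bdec ef /= ratr_nat.
move=> f0 fB; apply: le_trans.
have f0' : 0 <= ratr (rdec (bc1 f)) :> R by rewrite ler0q ltW.
by rewrite ler_sqr ?nnegrE ?ler0n.
Qed.

Lemma fine_cover g x y : ~ D (Some (x, y)) -> exists i j,
  [/\ (i < fine_width t g)%N, (j < fine_width t g)%N &
      in_basic (square i j (origin t * g.+1) (mesh t * g.+1)) (Some (x, y))].
Proof.
move=> /separation_box[xB yB].
have [i iW hx] := square_cover (fine_gt0 g) xB; have [j jW hy] := square_cover (fine_gt0 g) yB.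
rewrite !mulnA in iW jW hx hy; exists i, j; rewrite /fine_width /origin; split.
- by rewrite !mulnA.
- by rewrite !mulnA.
by apply/square_Some.
Qed.

Lemma coarse_index g i : (i < fine_width t g)%N -> (i %/ g.+1 < width t)%N.
Proof.
by rewrite ltn_divLR // /fine_width /width; nia.
Qed.

Lemma region_cover z : ~ D z -> exists2 l, (l < n)%N & region l z.
Proof.
move=> Kz; have [x [y zE]] := compl_finite Dinf Kz; rewrite {}zE in Kz *.
(* The refinement [g = 0] is the coarse grid itself, up to divisions by 1. *)
have [i [j [/coarse_index iW /coarse_index jW sq]]] := fine_cover 0 Kz.
have {}sq := square_refine mesh_gt0 sq.
have := lab_neq0 iW jW sq Kz; have : (lab n t (i %/ 1) (j %/ 1) < n.+1)%N by rewrite ltn_pmod.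
case E : (lab n t _ _) => [|l] // ln _; exists l => //.
by exists (i %/ 1)%N, (j %/ 1)%N.
Qed.

Lemma region_meets l : (l < n)%N -> exists2 z, region l z & ~ D z.
Proof.
move=> ln; move: sep => /and5P[_ _ _ _ /allP_iota/(_ l ln)/hasP_iota[i iW]].
move=> /hasP_iota[j jW /andP[/eqP labl /(has_listed_sound pBP mesh_gt0)[z [sqz]]]].
by move=> /(cboundary_open oD)[_ Kz]; exists z => //; exists i, j.
Qed.

(** [region l] and the union of the other regions are disjoint open sets covering the complement of
    D, so a connected subset lies on one side. *)
Lemma component_region c : exists2 l, (l < n)%N & forall z, C c z -> region l z.
Proof.
have [z0 Cz0] := labeling_nonempty labC c.
have [l ln lz0] := region_cover (labeling_sub labC Cz0); exists l => // z Cz.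
apply: contrapT => nlz; apply: (labeling_connected labC (l := c)).
exists (region l), (fun w => exists2 l', l' <> l & region l' w).
split; first exact: region_open.
split.
  move=> w [l' l'l /region_open[b [vb [bw bl']]]]; exists b; split=> //.
  by split=> // w' /bl' rw'; exists l'.
have cov w : C c w -> region l w \/ (exists2 l', l' <> l & region l' w).
  move=> /(labeling_sub labC)/region_cover[l' _ rw].
  by have [<-|/eqP l'l] := eqVneq l' l; [left|right; exists l'].
split=> //; split; first by exists z0.
split; first by exists z; split=> //; case: (cov z Cz).
by move=> w [_ [rl [l' l'l rl']]]; apply: l'l; apply: region_disjoint rl.
Qed.

Lemma region_components : exists2 psi : 'I_n -> 'I_n, bijective psi &
  forall (l : 'I_n) z, C (psi l) z <-> region l z /\ ~ D z.
Proof.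
have /choice[psi psiP] (l : 'I_n) : exists c, forall z, C c z -> region l z.
  have [z lz Kz] := region_meets (ltn_ord l).
  have [c Cz] := labeling_cover labC Kz; exists c.
  by have [l' _ cl'] := component_region c; rewrite (region_disjoint lz (cl' z Cz)).
(* Injective since distinct regions are disjoint, hence bijective by counting: here it matters that
   there are exactly [n] components. *)
have bij : bijective psi.
  apply: injF_bij => l l' E; have [z Cz] := labeling_nonempty labC (psi l).
  apply: ord_inj; apply: region_disjoint (psiP _ _ Cz) (psiP l' z _).
  by rewrite -E.
exists psi => // l z; split=> [Cz|[lz Kz]].
  by split; [exact: psiP|exact: (labeling_sub labC Cz)].
(* The component of [z] is [psi (phi c)], so [z] also lies in region [phi c], which must be region
   [l]. *)
have [c Cz] := labeling_cover labC Kz; have [phi _ phiK] := bij.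
rewrite -[c]phiK in Cz; suff -> : l = phi c by [].
exact/ord_inj/(region_disjoint lz (psiP _ _ Cz)).
Qed.

Section Names.
Variables (c : 'I_n) (l : nat).
Hypothesis cl : forall z, C c z <-> region l z /\ ~ D z.

Lemma open_test_sound f g s z : open_test pD n t l f g s -> in_basic_cl (bdec f) z -> ~ C c z.
Proof.
move=> /andP[okf /allP_iota h] fz /cl[rz Kz].
have [x [y zE]] := compl_finite Dinf Kz; rewrite {}zE in rz Kz fz.
have [i [j [iW jW sq]]] := fine_cover g Kz.
have sq' := square_refine mesh_gt0 sq.
move: (h i iW) => /allP_iota/(_ j jW)/or3P[/eqP labl|avoid|inD].
(* Two coarse squares contain the point and neither has label 0, so their labels agree, against the
   test. *)
- case: rz => [i' [j' [iW' jW' labl' sq'']]]; apply: labl; rewrite -labl'.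
  have nz := lab_neq0 (coarse_index iW) (coarse_index jW) sq' Kz.
  by apply: lab_eq (coarse_index iW) (coarse_index jW) iW' jW' nz _ sq' sq''; rewrite labl'.
- exact: bavoid_sound avoid sq fz.
- exact: Kz (in_listed_sound pDP (fine_gt0 g) inD sq).
Qed.

Lemma fine_small (a e : R) : 0 < e -> exists g, a / (mesh t * g.+1)%:R < e.
Proof.
move=> e0; have [a0|a0] := leP a 0.
  exists 0%N; apply: le_lt_trans e0.
  by rewrite pmulr_lle0 // invr_gt0 ltr0n.
have := archi_boundP (ltW (divr_gt0 a0 e0)); set g := Num.bound _ => h.
exists g; rewrite ltr_pdivrMr ?ltr0n // mulrC -ltr_pdivrMr //.
by apply: lt_le_trans h _; rewrite ler_nat (leq_trans (leqnSn g)) // leq_pmull.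
Qed.

Lemma fine_grid_box g i : (i < fine_width t g)%N ->
  - (box t)%:R <= gridq R i (origin t * g.+1) (mesh t * g.+1) <= (box t)%:R.
Proof.
rewrite /fine_width addn1 ltnS /origin -mulnA -(ler_nat R) => h.
have M0 : 0 < (mesh t * g.+1)%:R :> R by rewrite ltr0n.
rewrite /gridq ler_pdivlMr // ler_pdivrMr //.
move: h; rewrite mul2n -addnn natrD [(box t * _)%:R]natrM.
have i0 : 0 <= i%:R :> R by [].
move: ((mesh t * g.+1)%:R : R) ((box t)%:R : R) (i%:R : R) i0 => M B i' i0 h.
by apply/andP; split; lra.
Qed.

(** A point of the box is off the closure of the basic set, or in D, or in a region other than [l].
    All three conditions are open, and each implies the matching alternative of [open_test] for a
    small square about the point; a Lebesgue number gives the mesh. *)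
Lemma open_test_complete f : bok f -> (forall z, in_basic_cl (bdec f) z -> ~ C c z) ->
  exists g s, open_test pD n t l f g s.
Proof.
move=> okf fC; have B0 : - (box t)%:R <= (box t)%:R :> R by rewrite ge0_cp.
have [||e e0 eQ] := @lebesgue_number2 R (fun x y e =>
  [\/ forall z, ball x y e z -> ~ in_basic_cl (bdec f) z,
      forall z, ball x y e z -> D z | forall z, ball x y e z -> ~ region l z]) _ _ B0.
- move=> x y e e' ee' [] h; [apply: Or31|apply: Or32|apply: Or33] => z /(ball_le ee'); exact: h.
- move=> x y _ _.
  suff [e e0] : exists2 e, 0 < e &
      [\/ forall z, ball x y e z -> ~ in_basic_cl (bdec f) z,
      forall z, ball x y e z -> D z | forall z, ball x y e z -> ~ region l z].
    move=> h; exists (e / 2); first by rewrite divr_gt0.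
    move=> x' y' hx hy; have e2 : e / 2 + e / 2 <= e by rewrite -splitr.
    have sub z := @ball_shift R x y x' y' _ _ _ z (ltW hx) (ltW hy) e2.
    by case: h => h; [apply: Or31|apply: Or32|apply: Or33] => z /sub; exact: h.
  have [fxy|/in_basic_cl_closed[e e0 eP]] :=
    pselect (in_basic_cl (bdec f) (Some (x, y))); last by exists e => //; apply: Or31.
  have [Dxy|Kxy] := pselect (D (Some (x, y))).
    by have [e e0 eP] := copen_ball oD Dxy; exists e => //; apply: Or32.
  have [l' _ rl'] := region_cover Kxy.
  have [e e0 eP] := copen_ball (@region_open l') rl'; exists e => //; apply: Or33.
  move=> z /eP rz' rz; apply: (fC _ fxy); apply/cl; split=> //.
  by rewrite (region_disjoint rz rz').
have [g ge] := fine_small 2 e0; exists g.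
have [s sP] : exists s, forall i, (i < fine_width t g)%N -> forall j, (j < fine_width t g)%N ->
    [|| lab n t (i %/ g.+1) (j %/ g.+1) != l.+1,
        bavoid f i j (origin t * g.+1) (mesh t * g.+1)
      | in_listed pD s i j (origin t * g.+1) (mesh t * g.+1)].
  apply: (@common_stage (fun i s => forall j, (j < _)%N -> _)).
    move=> i s s' ss' h j jW; case/or3P: (h j jW) => [->//|->|h']; first by rewrite orbT.
    by rewrite (in_listed_mono ss') ?orbT.
  move=> i iW; apply: (@common_stage (fun j s => [|| _, _ | in_listed pD s i j _ _])).
    move=> j s s' ss' /or3P[->//|->|h']; first by rewrite orbT.
    by rewrite (in_listed_mono ss') ?orbT.
  move=> j jW; case: (eQ _ _ (fine_grid_box iW) (fine_grid_box jW)) => h.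
  - have -> : bavoid f i j (origin t * g.+1) (mesh t * g.+1).
      by apply: (bavoid_complete (R := R) _ okf) => // z /(ball_le (ltW ge)); apply: h.
    by exists 0%N; rewrite orbT.
  - have [s sP] : exists s, in_listed pD s i j (origin t * g.+1) (mesh t * g.+1).
      apply: (in_listed_complete pDP (fine_gt0 g)) => z.
      by move=> /(square_cl_ball (fine_gt0 g))/(ball_le (ltW ge)); apply: h.
    by exists s; rewrite sP !orbT.
  (* A fine square labelled [l.+1] would put its own centre into region [l]. *)
  - exists 0%N; apply/orP; left; apply/eqP => labl.
    apply: (h _ (ball_center _ _ e0)).
    exists (i %/ g.+1)%N, (j %/ g.+1)%N; split=> //; try exact: coarse_index.
    by apply: square_refine => //; apply: square_center.
exists s; rewrite /open_test okf /=.
by apply/allP_iota => i iW; apply/allP_iota => j jW; apply: sP.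
Qed.

(** Reduces the unknown boundary to the named one. A point of the component that is not a limit of D
    has a neighbourhood outside D, which near the point belongs to the same component, so the point
    is interior. *)
Lemma cboundary_component z : cboundary (C c) z <-> C c z /\ cboundary D z.
Proof.
split=> [[clz intz]|[Cz /(cboundary_open oD)[clz Kz]]]; last first.
  split; first by move=> b vb bz; exists z.
  move=> [b [vb [bz bC]]]; have [w [bw Dw]] := clz b vb bz.
  exact: (labeling_sub labC (bC w bw)) Dw.
have Cz := labeling_closed oD labC clz; split=> //.
apply/(cboundary_open oD); split; last exact: (labeling_sub labC Cz).
move=> b vb bz; apply: contrapT => nD; apply: intz.
have [x [y zE]] := compl_finite Dinf (labeling_sub labC Cz); rewrite {}zE in Cz bz *.
have [e e0 eb] := in_basic_open bz; have [e1 e10 e1C] := labeling_nbhs oD labC Cz.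
have [|b' [vb' bz' bb']] := @ball_basic R x y (Num.min e e1); first by rewrite lt_min e0.
exists b'; split=> //; split=> // w /bb' bw.
apply: e1C; first by apply: ball_le bw; rewrite ge_min lexx orbT.
move=> Dw; apply: nD; exists w; split=> //; apply: eb.
by apply: ball_le bw; rewrite ge_min lexx.
Qed.

Lemma boundary_test_sound f g s : boundary_test pB n t l f g s ->
  exists z, in_basic (bdec f) z /\ cboundary (C c) z.
Proof.
move=> /andP[okf /hasP_iota[i iW /hasP_iota[j jW /and3P[/eqP labl inf hl]]]].
have [z [sqz Bz]] := has_listed_sound pBP (fine_gt0 g) hl; exists z.
split; first exact: (bin_sound (fine_gt0 g) okf inf sqz).
have [_ Kz] := (cboundary_open oD z).1 Bz.
apply/cboundary_component; split=> //; apply/cl; split=> //.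
exists (i %/ g.+1)%N, (j %/ g.+1)%N; split=> //; try exact: coarse_index.
exact: square_refine.
Qed.

Lemma boundary_test_complete f z : bok f -> in_basic (bdec f) z -> cboundary (C c) z ->
  exists g s, boundary_test pB n t l f g s.
Proof.
move=> okf fz /cboundary_component[Cz Bz]; have [rz Kz] := (cl z).1 Cz.
have [x [y zE]] := compl_finite Dinf Kz; rewrite {}zE in fz Cz Bz rz Kz.
(* The constant 3 is the radius 2 required by [bin_complete] plus the distance 1 from the point to
   the centre of its square, in units of the fine mesh. *)
have [e e0 eb] := in_basic_open fz; have [g ge] := fine_small 3 e0.
have [i [j [iW jW sq]]] := fine_cover g Kz.
have [s sP] := has_listed_complete pBP (fine_gt0 g) sq Bz.
exists g, s; rewrite /boundary_test okf; apply/hasP_iota; exists i => //.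
apply/hasP_iota; exists j => //; rewrite sP andbT; apply/andP; split.
  have sq' := square_refine mesh_gt0 sq.
  case: rz => [i' [j' [iW' jW' labl' sq'']]]; rewrite -labl'; apply/eqP.
  have nz := lab_neq0 (coarse_index iW) (coarse_index jW) sq' Kz.
  by apply: lab_eq (coarse_index iW) (coarse_index jW) iW' jW' nz _ sq' sq''; rewrite labl'.
apply: (bin_complete (R := R) _ okf) => // w bw; apply: eb.
have [h1 h2] := square_ball (fine_gt0 g) sq.
by apply: ball_shift h1 h2 _ bw; rewrite -[X in _ + X]mul1r -mulrDl natr1 ltW.
Qed.
End Names.

Lemma out_valid : valid_output D n (out pD pB n t).
Proof.
have [psi [phi psiK phiK] psiP] := region_components.
(* Streams are numbered by regions, so the components are renumbered along [psi]. *)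
exists (C \o psi); split.
  have [isC [inj surj]] := labC; split; first by move=> l; apply: isC.
  split; first by move=> l l' /inj/(can_inj psiK).
  by move=> S /surj[c cS]; exists (phi c) => z; rewrite /= phiK.
move=> l; have cl := psiP l; split.
  split=> [k|b [vb bC]].
    rewrite /substream /out cpairK1 modnMr eqxx mulKn //.
    case: ifP => [h|_]; [right|by left]; set f := out_basic _ in h *.
    have okf : bok f by case/andP: h.
    exists (bdec f); rewrite pickle_bdec //; split=> //; split; first exact: bdec_valid.
    by move=> z; apply: open_test_sound h.
  have [f okf fb] := bdec_surj vb; rewrite -{}fb in vb bC *.
  have [g [s h]] := open_test_complete cl okf bC.
  exists (cpair f (cpair g s)).
  rewrite /substream /out /out_basic /out_refine /out_stage !(cpairK1, cpairK2).
  by rewrite modnMr eqxx mulKn // h pickle_bdec.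
have odd2 : ((2 * l).+1 %% 2 == 0)%N = false by rewrite modn2 /= mul2n odd_double.
have half2 : ((2 * l).+1 %/ 2 = l)%N by rewrite divn2 mul2n /= uphalf_double.
split=> [k|b [vb [z [bz Bz]]]].
  rewrite /substream /out cpairK1 odd2 half2.
  case: ifP => [h|_]; [right|by left]; set f := out_basic _ in h *.
  have okf : bok f by case/andP: h.
  exists (bdec f); rewrite pickle_bdec //; split=> //; split; first exact: bdec_valid.
  exact: boundary_test_sound cl _ _ _ h.
have [f okf fb] := bdec_surj vb; rewrite -{}fb in vb bz *.
have [g [s h]] := boundary_test_complete cl okf bz Bz.
exists (cpair f (cpair g s)).
rewrite /substream /out /out_basic /out_refine /out_stage !(cpairK1, cpairK2).
by rewrite odd2 half2 h pickle_bdec.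
Qed.
End Soundness.

Theorem theorem3p2 :
  forall R : realType,
  exists M : rf,
    rf_total4 M /\
    forall (D : cset R) (n : nat),
      cdomain D -> D None -> ~ D (Some (0%R : R, 0%R : R)) ->
      (exists C : 'I_n -> cset R, component_labeling (ccompl D) C) ->
      forall pD pB : nat -> nat,
        open_name D pD -> closed_name (cboundary D) pB ->
        exists q : nat -> nat,
          machine_computes M n pD pB q /\ valid_output D n q.
Proof.
move=> R; have [M [totM compM]] := machine_exists; exists M; split=> //.
move=> D n [oD _] Dinf _ [C labC] pD pB pDP pBP.
have [t sep Mt] := compM n pD pB (separation_exists oD Dinf labC pDP pBP).
by exists (out pD pB n t); split=> //; exact: (out_valid oD Dinf labC pDP pBP sep).
Qed.
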